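(* Let $\mathrm{X}\in\{\mathrm{A},\mathrm{B},\mathrm{C},\mathrm{D}\}$ and let $\iota$ be an infinite sequence of indices adapted to the Cartan matrix of type $\mathrm{X}_n$. Then $$\Xi_{\iota}=\mathrm{Tab}_{\mathrm{X},\iota}$$ as subsets of $(\mathbb{Q}^{\infty})^*$.
   Context: **Lie algebra.** $\mathfrak g$ is the finite-dimensional simple Lie algebra of type $\mathrm{X}_n$ ($\mathrm A_n$: $n\ge1$; $\mathrm B_n,\mathrm C_n$: $n\ge2$; $\mathrm D_n$: $n\ge4$), $I=\{1,\dots,n\}$, with Cartan matrix $a_{i,j}=\langle h_i,\alpha_j\rangle$ in Kac's convention: $a_{i,i}=2$; type $\mathrm A_n$: $a_{i,j}=-1$ if $|i-j|=1$; type $\mathrm B_n$: as $\mathrm A_n$ except $a_{n,n-1}=-2$; type $\mathrm C_n$: as $\mathrm A_n$ except $a_{n-1,n}=-2$; type $\mathrm D_n$: $a_{i,j}=-1$ if $|i-j|=1$ and $i,j\le n-1$, and $a_{n,n-2}=a_{n-2,n}=-1$; all other entries are $0$. **Adapted sequence.** $\iota=(\dots,i_3,i_2,i_1)$ is an infinite sequence in $I$ (written right to left) with $i_k\neq i_{k+1}$ for all $k\geq 1$ and $\#\{k: i_k=i\}=\infty$ for every $i\in I$. It is adapted to the Cartan matrix if for all $i\neq j$ in $I$ with $a_{i,j}\neq0$ the subsequence of $\iota$ consisting of all $i$'s and $j$'s is $(\dots,i,j,i,j)$ or $(\dots,j,i,j,i)$. **Operators.** $\mathbb{Q}^{\infty}=\{(\dots,a_2,a_1):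 a_k\in\mathbb{Q},\ a_k=0 \text{ for } k\gg0\}$, $(\mathbb{Q}^{\infty})^*=\mathrm{Hom}(\mathbb{Q}^{\infty},\mathbb{Q})$, and $x_k\in(\mathbb{Q}^\infty)^*$ ($k\ge1$) is the coordinate function $x_k(\dots,a_2,a_1)=a_k$. For $k\geq1$ put $k^{(+)}=\min\{l>k: i_l=i_k\}$ and $k^{(-)}=\max\{l<k: i_l=i_k\}$ if it exists, $k^{(-)}=0$ otherwise. Put $\beta_0=0$ and $\beta_k=x_k+\sum_{k<j<k^{(+)}}\langle h_{i_k},\alpha_{i_j}\rangle x_j+x_{k^{(+)}}$. For $\varphi=\sum_k\varphi_kx_k$ put $S_k(\varphi)=\varphi-\varphi_k\beta_k$ if $\varphi_k>0$ and $S_k(\varphi)=\varphi-\varphi_k\beta_{k^{(-)}}$ if $\varphi_k\leq0$. Finally $\Xi_{\iota}=\{S_{j_l}\cdots S_{j_1}x_{j_0} : l\geq0,\ j_0,\dots,j_l\geq1\}$. **Double indices.** If $i_k=j$ and $j$ appears exactly $s$ times among $i_k,i_{k-1},\dots,i_1$, write $x_{s,j}=x_k$. Conventions: $x_{m,0}=0$ for all $m\in\mathbb Z$; $x_{m,i}=0$ for $m\leq0$, $i\in I$; and in type $\mathrm A$, $x_{m,n+1}=0$ for all $m$. **The integers $P(k)$.** For $i\ne j$ with $a_{i,j}\neq0$: $p_{i,j}=1$ if the subsequence of $\iota$ consisting of $i,j$ is $(\dots,j,i,j,i)$, and $p_{i,j}=0$ if it is $(\dots,i,j,i,j)$. For $2\leq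 k\leq n$: $P(k)=p_{2,1}+p_{3,2}+\cdots+p_{k,k-1}$, except that in type $\mathrm D_n$ for $k=n$, $P(n)=p_{2,1}+p_{3,2}+\cdots+p_{n-2,n-3}+p_{n,n-2}$. Also $P(0)=P(1)=P(n+1)=0$. **Ordered sets.** $J_{\mathrm A}=\{1<2<\cdots<n+1\}$; $J_{\mathrm B}=J_{\mathrm C}=\{1<2<\cdots<n<\overline n<\cdots<\overline 2<\overline1\}$; $J_{\mathrm D}=\{1,\dots,n,\overline n,\dots,\overline1\}$ with the partial order $1<\cdots<n-1<n<\overline{n-1}<\cdots<\overline1$, $n-1<\overline n<\overline{n-1}$, where $n$ and $\overline n$ are incomparable. $|j|=|\overline j|=j$ for $1\le j\le n$. **Boxes** ($s\in\mathbb{Z}$), writing $\boxed{j}^{\mathrm X}_s\in(\mathbb Q^\infty)^*$: Type A: $\boxed{j}^{\mathrm A}_s=x_{s+P(j),j}-x_{s+P(j-1)+1,j-1}$ ($1\leq j\leq n+1$). Type B: for $1\le j\le n$, $\boxed{j}^{\mathrm B}_s=x_{s+P(j),j}-x_{s+P(j-1)+1,j-1}$, $\boxed{\overline j}^{\mathrm B}_s=x_{s+P(j-1)+n-j+1,j-1}-x_{s+P(j)+n-j+1,j}$. Type C: for $1\le j\le n-1$, $\boxed{j}^{\mathrm C}_s=x_{s+P(j),j}-x_{s+P(j-1)+1,j-1}$, $\boxed{\overline j}^{\mathrm C}_s=x_{s+P(j-1)+n-j+1,j-1}-x_{s+P(j)+n-j+1,j}$; $\boxed{n}^{\mathrm C}_s=2x_{s+P(n),n}-x_{s+P(n-1)+1,n-1}$;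 $\boxed{\overline n}^{\mathrm C}_s=x_{s+P(n-1)+1,n-1}-2x_{s+P(n)+1,n}$; $\boxed{\overline{n+1}}^{\mathrm C}_s=x_{s+P(n),n}$. Type D: $\boxed{j}^{\mathrm D}_s=x_{s+P(j),j}-x_{s+P(j-1)+1,j-1}$ ($1\le j\le n-2$ or $j=n$); $\boxed{n-1}^{\mathrm D}_s=x_{s+P(n-1),n-1}+x_{s+P(n),n}-x_{s+P(n-2)+1,n-2}$; $\boxed{\overline n}^{\mathrm D}_s=x_{s+P(n-1),n-1}-x_{s+P(n)+1,n}$; $\boxed{\overline{n-1}}^{\mathrm D}_s=x_{s+P(n-2)+1,n-2}-x_{s+P(n-1)+1,n-1}-x_{s+P(n)+1,n}$; $\boxed{\overline j}^{\mathrm D}_s=x_{s+P(j-1)+n-j,j-1}-x_{s+P(j)+n-j,j}$ ($1\le j\le n-2$); $\boxed{\overline{n+1}}^{\mathrm D}_s=x_{s+P(n),n}$. **Tableaux.** $[j_1,\dots,j_k]^{\mathrm X}_s=\sum_{i=1}^k\boxed{j_i}^{\mathrm X}_{s+k-i}$. $\mathrm{Tab}_{\mathrm A,\iota}$: all $[j_1,\dots,j_k]^{\mathrm A}_s$ with $k\in I$, $1\leq j_1<\cdots<j_k\leq n+1$, $s\geq1-P(k)$. $\mathrm{Tab}_{\mathrm B,\iota}$: all $[j_1,\dots,j_k]^{\mathrm B}_s$ with $k\in I$, $j_i\in J_{\mathrm B}$, $j_1<\cdots<j_k$, $s\ge1-P(k)$, and, if $k=n$, additionally $|j_l|\neq|j_m|$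 for $l\neq m$. $\mathrm{Tab}_{\mathrm C,\iota}$: all $[j_1,\dots,j_k]^{\mathrm C}_s$ such that either $j_1,\dots,j_k\in J_{\mathrm C}$, $1\le k\le n-1$, $j_1<\cdots<j_k$, $s\geq1-P(k)$; or $j_1=\overline{n+1}$, $1\le k\le n+1$, $j_2,\dots,j_k\in J_{\mathrm C}$ with $\overline n\le j_2<\cdots<j_k\leq\overline1$, $s\ge1-P(n)$. $\mathrm{Tab}_{\mathrm D,\iota}$: all $[j_1,\dots,j_k]^{\mathrm D}_s$ such that either $j_1,\dots,j_k\in J_{\mathrm D}$, $1\le k\le n-2$, $j_l\ngeq j_{l+1}$ for $1\le l<k$, $s\ge1-P(k)$; or $j_1=\overline{n+1}$, $1\le k\le n+1$, $\overline n\le j_2<\cdots<j_k\leq\overline1$, and $s\geq1-P(n-1)$ if $k$ is even, $s\ge1-P(n)$ if $k$ is odd. *)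

(* Defs.v *)
From HB Require Import structures.
From mathcomp Require Import all_boot all_order all_algebra finmap.
From mathcomp Require Import boolp classical_sets functions cardinality.
From mathcomp Require Import monalg.
Set Implicit Arguments. Unset Strict Implicit. Unset Printing Implicit Defensive.
Import Order.TTheory GRing.Theory Num.Theory.
Local Open Scope ring_scope.

(* Sequences (..., a_2, a_1) of rationals with finitely many nonzero entries,
   as finitely supported functions nat -> rat.  The entry a_k (k >= 1) is the
   value at k.-1, so that no spurious entry a_0 is introduced. *)
Notation Qinf := {malg rat[nat]}.

Notation Qinf_dual := {linear Qinf -> rat^o}.

(* Hom(Q^oo, Q) with its pointwise vector space structure. *)
Lemma Qinf_dualP (f g : Qinf_dual) : f =1 g -> f = g.
Proof.
case: f g => [f [[f0] [fZ]]] [g [[g0] [gZ]]] /= fg.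
have {}fg : f = g by apply: funext.
by subst g; rewrite (Prop_irrelevance f0 g0) (Prop_irrelevance fZ gZ).
Qed.

HB.instance Definition _ := gen_eqMixin Qinf_dual.
HB.instance Definition _ := gen_choiceMixin Qinf_dual.

Section DualSpace.
Implicit Types f g h : Qinf_dual.

Let dzero : Qinf_dual := \0.
Let dadd f g : Qinf_dual := f \+ g.
Let dopp f : Qinf_dual := \- f.
Let dscale (c : rat) f : Qinf_dual := c \*: f.

Fact Qinf_dual_addA : associative dadd.
Proof. by move=> f g h; apply: Qinf_dualP => a /=; rewrite addrA. Qed.
Fact Qinf_dual_addC : commutative dadd.
Proof. by move=> f g; apply: Qinf_dualP => a /=; rewrite addrC. Qed.
Fact Qinf_dual_add0 : left_id dzero dadd.
Proof. by move=> f; apply: Qinf_dualP => a /=; rewrite add0r. Qed.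
Fact Qinf_dual_addN : left_inverse dzero dopp dadd.
Proof. by move=> f; apply: Qinf_dualP => a /=; rewrite addNr. Qed.

HB.instance Definition _ := GRing.isZmodule.Build Qinf_dual
  Qinf_dual_addA Qinf_dual_addC Qinf_dual_add0 Qinf_dual_addN.

Fact Qinf_dual_scaleA c d f : dscale c (dscale d f) = dscale (c * d) f.
Proof. by apply: Qinf_dualP => a /=; rewrite scalerA. Qed.
Fact Qinf_dual_scale1 : left_id 1 dscale.
Proof. by move=> f; apply: Qinf_dualP => a /=; rewrite scale1r. Qed.
Fact Qinf_dual_scaleDr : right_distributive dscale +%R.
Proof. by move=> c f g; apply: Qinf_dualP => a /=; rewrite scalerDr. Qed.
Fact Qinf_dual_scaleDl f : {morph dscale^~ f : c d / c + d}.
Proof. by move=> c d; apply: Qinf_dualP => a /=; rewrite scalerDl. Qed.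

HB.instance Definition _ := GRing.Zmodule_isLmodule.Build rat Qinf_dual
  Qinf_dual_scaleA Qinf_dual_scale1 Qinf_dual_scaleDr Qinf_dual_scaleDl.

End DualSpace.

Definition coord_fun (k : nat) (a : Qinf) : rat^o := a@_(k.-1)%N.

Fact coord_fun_linear k : linear (coord_fun k).
Proof. by move=> c a b; rewrite /coord_fun mcoeffD mcoeffZ. Qed.

HB.instance Definition _ k :=
  GRing.isLinear.Build rat Qinf rat^o _ (coord_fun k) (coord_fun_linear k).

(* The coordinate function x_k; meaningful for k >= 1 only. *)
Definition x_ (k : nat) : Qinf_dual := coord_fun k.

(* The coefficient phi_k of phi = \sum_k phi_k x_k, i.e. the value of phi at
   the k-th unit vector (k >= 1). *)
Definition coef (phi : Qinf_dual) (k : nat) : rat := phi << 1 *g k.-1 >>.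

Inductive cartan_type := TypeA | TypeB | TypeC | TypeD.

Definition valid_rank (X : cartan_type) (n : nat) : bool :=
  match X with
  | TypeA => 1 <= n
  | TypeB | TypeC => 2 <= n
  | TypeD => 4 <= n
  end%N.

(* The index set I = {1, ..., n}. *)
Definition in_I (n i : nat) : bool := (1 <= i <= n)%N.

Definition adjacent (i j : nat) : bool := (i == j.+1) || (j == i.+1).

(* a_{i,j} = <h_i, alpha_j>, for i, j in I. *)
Definition cartan (X : cartan_type) (n i j : nat) : int :=
  if i == j then 2 else
  match X with
  | TypeA => if adjacent i j then -1 else 0
  | TypeB => if (i == n) && (j == n.-1) then -2
             else if adjacent i j then -1 else 0
  | TypeC => if (i == n.-1) && (j == n) then -2
             else if adjacent i j then -1 else 0
  | TypeD => if [&& adjacent i j, i <= n.-1 & j <= n.-1]%N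
                || ((i == n) && (j == n - 2)%N)
                || ((i == n - 2)%N && (j == n)) then -1 else 0
  end.

(* A sequence (..., i_3, i_2, i_1) is a function w : nat -> nat with w k = i_k
   for k >= 1; the value w 0 is never used. *)
Definition index_sequence (n : nat) (w : nat -> nat) : Prop :=
  [/\ forall k, (1 <= k)%N -> in_I n (w k),
      forall k, (1 <= k)%N -> w k <> w k.+1 &
      forall i, in_I n i -> infinite_set [set k | (1 <= k)%N /\ w k = i]].

(* The entries equal to i or j among i_1, ..., i_N, listed from i_1 on. *)
Definition subseq_of (w : nat -> nat) (i j N : nat) : seq nat :=
  [seq l <- [seq w k | k <- iota 1 N] | (l == i) || (l == j)].

(* The subsequence of all i's and j's is (..., j, i, j, i): read from the
   right, it is i, j, i, j, ... *)
Definition alternates (w : nat -> nat) (i j : nat) : Prop :=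
  forall N, let s := subseq_of w i j N in
  s = mkseq (fun t => if odd t then j else i) (size s).

Definition adapted (X : cartan_type) (n : nat) (w : nat -> nat) : Prop :=
  forall i j, in_I n i -> in_I n j -> i <> j -> cartan X n i j <> 0 ->
  alternates w i j \/ alternates w j i.

(* The least m with Q m, and 0 if there is none. *)
Definition least (Q : pred nat) : nat :=
  if pselect (exists m, Q m) is left exQ then ex_minn exQ else 0%N.

Definition kplus (w : nat -> nat) (k : nat) : nat :=
  least (fun l => (k < l)%N && (w l == w k)).

(* The empty maximum is 0, as required. *)
Definition kminus (w : nat -> nat) (k : nat) : nat :=
  \max_(1 <= l < k | w l == w k) l.

Definition beta (X : cartan_type) (n : nat) (w : nat -> nat) (k : nat) :
    Qinf_dual :=
  if k == 0%N then 0 else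
  x_ k + \sum_(k.+1 <= j < kplus w k) (cartan X n (w k) (w j))%:~R *: x_ j
      + x_ (kplus w k).

Definition S_op (X : cartan_type) (n : nat) (w : nat -> nat) (k : nat)
    (phi : Qinf_dual) : Qinf_dual :=
  if 0 < coef phi k then phi - coef phi k *: beta X n w k
  else phi - coef phi k *: beta X n w (kminus w k).

(* js lists j_1, ..., j_l; S_{j_1} is applied first. *)
Definition Xi (X : cartan_type) (n : nat) (w : nat -> nat) : set Qinf_dual :=
  [set phi | exists (j0 : nat) (js : seq nat),
    [/\ (1 <= j0)%N, all (fun j => 1 <= j)%N js &
        phi = foldl (fun psi j => S_op X n w j psi) (x_ j0) js]].

(* x_{m,j} = x_k for the k >= 1 such that i_k = j and j occurs exactly m times
   among i_k, ..., i_1.  There is no such k when m <= 0 or when j is not in I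
   (in particular j = 0 or j = n + 1), and then x_{m,j} = 0. *)
Definition xx (w : nat -> nat) (m : int) (j : nat) : Qinf_dual :=
  let k := least (fun k => [&& (1 <= k)%N, w k == j &
                     (count_mem j [seq w l | l <- iota 1 k])%:Z == m]) in
  if k == 0%N then 0 else x_ k.

(* p_{i,j}, used for i <> j with a_{i,j} <> 0 only. *)
Definition p_ (w : nat -> nat) (i j : nat) : nat := `[< alternates w i j >].

Definition P_ (X : cartan_type) (n : nat) (w : nat -> nat) (k : nat) : nat :=
  if (2 <= k <= n)%N then
    match X with
    | TypeD => if k == n
               then (\sum_(2 <= i < n.-1) p_ w i i.-1 + p_ w n (n - 2))%N
               else (\sum_(2 <= i < k.+1) p_ w i i.-1)%N
    | _ => (\sum_(2 <= i < k.+1) p_ w i i.-1)%N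
    end
  else 0%N.

(* Box labels: Plain j is j and Bar j is \overline{j}. *)
Inductive label := Plain of nat | Bar of nat.

Definition absl (a : label) : nat :=
  match a with Plain j => j | Bar j => j end.

Definition eql (a b : label) : bool :=
  match a, b with
  | Plain i, Plain j | Bar i, Bar j => i == j
  | _, _ => false
  end.

(* The ordered set J_X; the additional label \overline{n+1} of types C and D
   does not belong to it. *)
Definition in_J (X : cartan_type) (n : nat) (a : label) : bool :=
  match X, a with
  | TypeA, Plain j => (1 <= j <= n.+1)%N
  | TypeA, Bar _ => false
  | _, _ => (1 <= absl a <= n)%N
  end.

(* The strict order of J_X; in type D, n and \overline{n} are incomparable. *)
Definition ltJ (X : cartan_type) (n : nat) (a b : label) : bool :=
  match a, b with
  | Plain i, Plain j => (i < j)%N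
  | Bar i, Bar j => (j < i)%N
  | Plain i, Bar j => if X is TypeD then ~~ ((i == n) && (j == n)) else true
  | Bar _, Plain _ => false
  end.

Definition leJ (X : cartan_type) (n : nat) (a b : label) : bool :=
  eql a b || ltJ X n a b.

Section Boxes.
Variables (n : nat) (w : nat -> nat).

Definition boxA (a : label) (s : int) : Qinf_dual :=
  let P k := (P_ TypeA n w k)%:Z in
  match a with
  | Plain j => xx w (s + P j) j - xx w (s + P j.-1 + 1) j.-1
  | Bar _ => 0
  end.

Definition boxB (a : label) (s : int) : Qinf_dual :=
  let P k := (P_ TypeB n w k)%:Z in
  match a with
  | Plain j => xx w (s + P j) j - xx w (s + P j.-1 + 1) j.-1
  | Bar j => xx w (s + P j.-1 + n%:Z - j%:Z + 1) j.-1
             - xx w (s + P j + n%:Z - j%:Z + 1) j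
  end.

Definition boxC (a : label) (s : int) : Qinf_dual :=
  let P k := (P_ TypeC n w k)%:Z in
  match a with
  | Plain j =>
      if j == n then xx w (s + P n) n *+ 2 - xx w (s + P n.-1 + 1) n.-1
      else xx w (s + P j) j - xx w (s + P j.-1 + 1) j.-1
  | Bar j =>
      if j == n.+1 then xx w (s + P n) n
      else if j == n then
        xx w (s + P n.-1 + 1) n.-1 - xx w (s + P n + 1) n *+ 2
      else xx w (s + P j.-1 + n%:Z - j%:Z + 1) j.-1
           - xx w (s + P j + n%:Z - j%:Z + 1) j
  end.

Definition boxD (a : label) (s : int) : Qinf_dual :=
  let P k := (P_ TypeD n w k)%:Z in
  match a with
  | Plain j =>
      if j == n.-1 then
        xx w (s + P n.-1) n.-1 + xx w (s + P n) n
        - xx w (s + P (n - 2)%N + 1) (n - 2)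
      else xx w (s + P j) j - xx w (s + P j.-1 + 1) j.-1
  | Bar j =>
      if j == n.+1 then xx w (s + P n) n
      else if j == n then xx w (s + P n.-1) n.-1 - xx w (s + P n + 1) n
      else if j == n.-1 then
        xx w (s + P (n - 2)%N + 1) (n - 2)
        - xx w (s + P n.-1 + 1) n.-1 - xx w (s + P n + 1) n
      else xx w (s + P j.-1 + n%:Z - j%:Z) j.-1
           - xx w (s + P j + n%:Z - j%:Z) j
  end.

End Boxes.

Definition box (X : cartan_type) :=
  match X with
  | TypeA => boxA | TypeB => boxB | TypeC => boxC | TypeD => boxD
  end.

(* [j_1, ..., j_k]_s for js = [:: j_1; ...; j_k]; the entry of (0-based) index
   i is j_{i+1}, hence the shift s + k - (i + 1). *)
Definition tableau (X : cartan_type) (n : nat) (w : nat -> nat)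
    (js : seq label) (s : int) : Qinf_dual :=
  \sum_(i < size js)
    box X n w (nth (Plain 0) js i) (s + (size js)%:Z - (i.+1)%:Z).

Definition increasing (X : cartan_type) (n : nat) (js : seq label) : bool :=
  sorted (ltJ X n) js.

(* Consecutive entries satisfy: not j_l >= j_{l+1}. *)
Definition non_descending (X : cartan_type) (n : nat) (js : seq label) : bool :=
  sorted (fun a b => ~~ leJ X n b a) js.

(* js = [:: \overline{n+1}, j_2, ..., j_k] with k <= n + 1 and
   \overline{n} <= j_2 < ... < j_k <= \overline{1} in J_X. *)
Definition spin_column (X : cartan_type) (n : nat) (js : seq label) : Prop :=
  exists2 js' : seq label, js = Bar n.+1 :: js' &
    [/\ (size js <= n.+1)%N, all (in_J X n) js',
        all (fun a => leJ X n (Bar n) a && leJ X n a (Bar 1)) js' &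
        increasing X n js'].

Definition TabA (n : nat) (w : nat -> nat) : set Qinf_dual :=
  [set phi | exists (js : seq label) (s : int), let k := size js in
    [/\ in_I n k, all (in_J TypeA n) js, increasing TypeA n js,
        1 - (P_ TypeA n w k)%:Z <= s & phi = tableau TypeA n w js s]].

Definition TabB (n : nat) (w : nat -> nat) : set Qinf_dual :=
  [set phi | exists (js : seq label) (s : int), let k := size js in
    [/\ in_I n k, all (in_J TypeB n) js && increasing TypeB n js,
        1 - (P_ TypeB n w k)%:Z <= s,
        k = n -> uniq [seq absl a | a <- js] &
        phi = tableau TypeB n w js s]].

Definition TabC (n : nat) (w : nat -> nat) : set Qinf_dual :=
  [set phi | exists (js : seq label) (s : int), let k := size js in
    phi = tableau TypeC n w js s /\
    ([/\ (1 <= k <= n.-1)%N, all (in_J TypeC n) js, increasing TypeC n js &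
         1 - (P_ TypeC n w k)%:Z <= s]
     \/ spin_column TypeC n js /\ 1 - (P_ TypeC n w n)%:Z <= s)].

Definition TabD (n : nat) (w : nat -> nat) : set Qinf_dual :=
  [set phi | exists (js : seq label) (s : int), let k := size js in
    phi = tableau TypeD n w js s /\
    ([/\ (1 <= k <= n - 2)%N, all (in_J TypeD n) js, non_descending TypeD n js &
         1 - (P_ TypeD n w k)%:Z <= s]
     \/ spin_column TypeD n js /\
        1 - (P_ TypeD n w (if odd k then n else n.-1))%:Z <= s)].

Definition Tab (X : cartan_type) : nat -> (nat -> nat) -> set Qinf_dual :=
  match X with
  | TypeA => TabA | TypeB => TabB | TypeC => TabC | TypeD => TabD
  end.

(* Main.v *)
Require Import Defs.
From HB Require Import structures.
From mathcomp Require Import all_boot all_order all_algebra finmap.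
From mathcomp Require Import boolp classical_sets cardinality monalg.
From mathcomp Require Import zify ring.
Set Implicit Arguments. Unset Strict Implicit. Unset Printing Implicit Defensive.
Import Order.TTheory GRing.Theory Num.Theory.
Local Open Scope ring_scope.

(** Put y_(c,t) = x_(t+P(c),c).  In these coordinates the sequence disappears
from the forms beta: if position k carries y_(c,t), then adaptedness gives
  beta_k = y_(c,t) + y_(c,t+1) + sum_(e<c) a_(c,e) y_(e,t+1)
                               + sum_(e>c) a_(c,e) y_(e,t) =: B_(c,t)
([betaE]), and beta of the previous position of c, if there is one, is
B_(c,t-1).  The sequence only decides which pairs (c,t) are positions: those
with t + P(c) >= 1.

Moving a letter one step up in J_X subtracts a multiple of some B from its box:
box(x)_s - box(x')_s = m B_(c,s+lag) ([box_step1], [box_step2]).  Every node c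
owns at most two such steps x -> x'.  By duality, the coefficient of a tableau
at y_(c,t) is m times its excess: the number of those steps whose source x
stands at the depth matching t, minus the number of those whose target x'
stands one row lower ([coef_column_sum]).  A step with positive contribution
can be raised without violating the order of the column, and one with negative
contribution can be lowered.  When the excess is v, the operator S changes
exactly |v| letters in this way, so it maps columns to columns with the same
length and the same s ([stable_column]).

The remaining tableaux are spin tableaux: y_(n,s+r) plus a multiple of a column
of r barred letters.  In types C and D this is the definition, the leading
letter contributing y_(n,s+r).  In type B, a column of length n containing one
letter of each absolute value is of this form, because the boxes of its
unbarred letters telescope to y_n plus the boxes of the barred ones
([column_sum_word]).  Here S also adds or removes the letters on top
([stable_spin]).  Since every x_k is a tableau, Xi is contained in Tab.

Conversely, a column different from (1,...,k) is reached from a smaller one: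
take its first entry that differs from its row number and lower it by one step
of some node c; S raises it again, provided that the other step of c does not
contribute.  If that step contributes negatively, its target can be lowered
instead.  If it contributes positively, the column contains j+1 and its bar at
a distance where both can be replaced by j and its bar without changing the
sum ([step_plain]).  All these moves decrease a weight, and s >= 1 - P(k)
guarantees that the required positions exist ([Xi_column], [Xi_spin]). *)

(** * Evaluation and coefficients of linear forms *)
Definition ev (v : Qinf) (f : Qinf_dual) : rat := f v.
Lemma ev_inj (f g : Qinf_dual) : (forall v, ev v f = ev v g) -> f = g.
Proof. exact: Qinf_dualP. Qed.
Lemma evD v (f g : Qinf_dual) : ev v (f + g) = ev v f + ev v g.
Proof. by []. Qed.
Lemma evN v (f : Qinf_dual) : ev v (- f) = - ev v f.
Proof. by []. Qed.
Lemma evZ v c (f : Qinf_dual) : ev v (c *: f) = c * ev v f.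
Proof. by []. Qed.
Lemma ev0 v : ev v 0 = 0.
Proof. by []. Qed.
Lemma evMn v (f : Qinf_dual) m : ev v (f *+ m) = ev v f *+ m.
Proof. by elim: m => // m IH; rewrite !mulrS evD IH. Qed.
Definition evE := (evD, evN, evZ, evMn, ev0).

(** Identities between linear forms are checked pointwise, where [ring] applies. *)
Ltac vec_ring := apply: ev_inj => v; rewrite ?evE; ring.

Lemma coefD f g k : coef (f + g) k = coef f k + coef g k.
Proof. by []. Qed.
Lemma coefN f k : coef (- f) k = - coef f k.
Proof. by []. Qed.
Lemma coefZ c f k : coef (c *: f) k = c * coef f k.
Proof. by []. Qed.
Lemma coef0 k : coef 0 k = 0.
Proof. by []. Qed.
Lemma coefMn f m k : coef (f *+ m) k = coef f k *+ m.
Proof. exact: evMn. Qed.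
Definition coefE := (coefD, coefN, coefZ, coefMn, coef0).

Lemma coef_x (l k : nat) : (1 <= l)%N -> (1 <= k)%N -> coef (x_ l) k = (l == k)%:R.
Proof.
move=> l1 k1; rewrite /coef /x_ /= /coord_fun mcoeffU eq_sym.
by rewrite (_ : (l.-1 == k.-1) = (l == k)) //; lia.
Qed.

(** * Occurrences of a letter in the sequence *)
Lemma leastP (Q : pred nat) m : Q m -> Q (least Q).
Proof.
move=> Qm; rewrite /least; case: pselect => [e|[]]; last by exists m.
by case: ex_minnP.
Qed.
Lemma least_min (Q : pred nat) m : Q m -> (least Q <= m)%N.
Proof.
move=> Qm; rewrite /least; case: pselect => [e|[]]; last by exists m.
by case: ex_minnP => i _; apply.
Qed.
Lemma least0 (Q : pred nat) : (forall m, ~~ Q m) -> least Q = 0%N.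
Proof.
by move=> nQ; rewrite /least; case: pselect => // e; case: (e) => m Qm; case/negP: (nQ m).
Qed.

Definition occ_count (w : nat -> nat) (k c : nat) : nat :=
  count_mem c [seq w l | l <- iota 1 k].

Lemma occ_countS w k c : occ_count w k.+1 c = (occ_count w k c + (w k.+1 == c))%N.
Proof. by rewrite /occ_count -(addn1 k) iotaD map_cat count_cat /= addn0 add1n addn1. Qed.

Lemma occ_count_le w k l c : (k <= l)%N -> (occ_count w k c <= occ_count w l c)%N.
Proof.
move=> /subnK <-; elim: (l - k)%N => // d IH.
by rewrite addSn occ_countS (leq_trans IH) ?leq_addr.
Qed.

Lemma occ_count_lt w k l c : (k < l)%N -> w l = c -> (occ_count w k c < occ_count w l c)%N.
Proof.
case: l => // l kl wl; rewrite occ_countS wl eqxx addn1 ltnS; exact: occ_count_le.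
Qed.

Lemma occ_count_inj w k l c : w k = c -> w l = c -> occ_count w k c = occ_count w l c -> k = l.
Proof.
move=> wk wl e; case: (ltngtP k l) => // lt.
- by have := occ_count_lt lt wl; lia.
- by have := occ_count_lt lt wk; lia.
Qed.

Lemma occ_count_gt0 w k : (1 <= k)%N -> (1 <= occ_count w k (w k))%N.
Proof. by case: k => // k _; rewrite occ_countS eqxx addn1. Qed.

Lemma occ_count_attained w c m l : (1 <= m <= occ_count w l c)%N ->
  exists k, [/\ (1 <= k <= l)%N, w k = c & occ_count w k c = m].
Proof.
elim: l => [|l IH]; first by rewrite /occ_count /=; lia.
move=> /andP[m1 ml]; have [le|gt] := leqP m (occ_count w l c).
  have [|k [k1 k2 k3]] := IH; first by rewrite m1.
  by exists k; split => //; lia.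
exists l.+1; split; [lia| |]; move: ml gt; rewrite !occ_countS; case: eqP => // _; lia.
Qed.

Lemma infinite_set_unbounded (A : set nat) N : infinite_set A -> exists2 k, A k & (N < k)%N.
Proof.
move=> infA; apply: contrapT => nex; apply: infA.
apply: (sub_finite_set _ (finite_II N.+1)) => k Ak /=; rewrite ltnS leqNgt.
by apply/negP => lt; apply: nex; exists k.
Qed.

Lemma xxE w k : (1 <= k)%N -> xx w (occ_count w k (w k))%:Z (w k) = x_ k.
Proof.
move=> k1; rewrite /xx; set Q := (fun k0 => _).
have Qk : Q k by rewrite /Q k1 !eqxx.
have /and3P[l1 /eqP wl /eqP[cl]] := leastP Qk.
have -> : least Q = k by apply: (@occ_count_inj w _ _ (w k)).
by rewrite gtn_eqF.
Qed.

Lemma xx_cases w m c : xx w m c = 0 \/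
  exists k, [/\ (1 <= k)%N, w k = c, m = (occ_count w k c)%:Z & xx w m c = x_ k].
Proof.
rewrite /xx; set Q := (fun k0 => _).
have [[k Qk]|nQ] := pselect (exists k, Q k).
  right; exists (least Q); have /and3P[l1 /eqP wl /eqP cl] := leastP Qk.
  by split => //; rewrite gtn_eqF.
left; rewrite least0 // => m0; apply/negP => Qm; apply: nQ; by exists m0.
Qed.

Lemma coef_xx w m c k : (1 <= k)%N ->
  coef (xx w m c) k = ((w k == c) && (m == (occ_count w k c)%:Z))%:R.
Proof.
move=> k1; case: (xx_cases w m c) => [e|[l [l1 wl -> ->]]]; last first.
  rewrite coef_x //; case: (eqVneq l k) => [<-|lk]; first by rewrite wl !eqxx.
  case: eqP => // wk; case: eqP => // -[] /(occ_count_inj wl wk) e.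
  by rewrite e eqxx in lk.
rewrite e coef0; case: eqP => // wk; case: eqP => // em; exfalso.
have := coef_x k1 k1; rewrite -(xxE w k1) wk -em e coef0 eqxx => /eqP.
by rewrite eq_sym oner_eq0.
Qed.

(** Only this consequence of alternation is used: of two alternating letters,
the one that starts is ahead by zero or one occurrence at any moment. *)
Lemma alternates_occ_count w i j N : i <> j -> alternates w i j ->
  (occ_count w N j <= occ_count w N i <= (occ_count w N j).+1)%N.
Proof.
move=> ij /(_ N) /=; set s := subseq_of w i j N => e.
have cE c : (c == i) || (c == j) -> occ_count w N c = count_mem c s.
  move=> hc; rewrite /s /subseq_of count_filter /occ_count; apply: eq_count => x /=.
  by case: (eqVneq x c) => //= ->; rewrite hc.
rewrite !cE ?eqxx ?orbT // e; elim: (size s) => [|m IH] //.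
rewrite mkseqS -!cats1 !count_cat /= !addn0.
have cc x : (count_mem i (mkseq (fun t => if odd t then j else i) x) = uphalf x)%N /\
            (count_mem j (mkseq (fun t => if odd t then j else i) x) = x./2)%N.
  elim: x {IH} => [|x [h1 h2]] //.
  rewrite mkseqS -!cats1 !count_cat h1 h2 /= !addn0.
  have /eqP/negbTE ji : j <> i by move=> eji; apply: ij.
  have /eqP/negbTE ij' := ij.
  have := odd_double_half x; rewrite uphalf_half.
  case: (odd x) => /=; rewrite !eqxx ?ij' ?ji; lia.
have [-> ->] := cc m; have := odd_double_half m; rewrite uphalf_half.
have /eqP/negbTE ji : j <> i by move=> eji; apply: ij.
have /eqP/negbTE ij' := ij.
case: (odd m) => /=; rewrite !eqxx ?ij' ?ji; lia.
Qed.

Lemma kminusP w k : (1 <= k)%N ->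
  (kminus w k = 0%N /\ occ_count w k (w k) = 1%N) \/
  [/\ (1 <= kminus w k)%N, w (kminus w k) = w k &
      occ_count w k (w k) = (occ_count w (kminus w k) (w k)).+1].
Proof.
move=> k1; have c1 := occ_count_gt0 w k1.
have ub l : (1 <= l < k)%N -> w l = w k -> (l <= kminus w k)%N.
  move=> lk wl; rewrite /kminus.
  apply: (@leq_bigmax_seq _ _ (fun l => w l == w k) id l).
  - by rewrite mem_index_iota.
  - by rewrite wl.
have [e|ne] := eqVneq (occ_count w k (w k)) 1%N.
  left; split => //; rewrite /kminus big_nat_cond big1 // => l /andP[/andP[l1 lk] /eqP wl].
  have := occ_count_lt lk (erefl (w k)); have := occ_count_gt0 w l1; rewrite wl; lia.
right; have [|l [/andP[l1 lk] wl cl]] := @occ_count_attained w (w k) (occ_count w k (w k)).-1 k; first by lia.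
have ltk : (l < k)%N by rewrite ltn_neqAle lk andbT; apply/eqP => e; move: cl; rewrite e; lia.
have lkm := ub l ltac:(lia) wl.
have [i /andP[/andP[i1 ik] /eqP wi] ei] : exists2 i, (1 <= i < k)%N && (w i == w k) & kminus w k = i.
  have : forall s : seq nat, all (fun i => 1 <= i < k)%N s ->
     (0 < \max_(l <- s | w l == w k) l)%N ->
     exists2 i, (1 <= i < k)%N && (w i == w k) & \max_(l <- s | w l == w k) l = i.
    elim=> [|a s IH] /=; first by rewrite big_nil.
    move=> /andP[ha hs]; rewrite big_cons; case: (eqVneq (w a) (w k)) => e; last exact: IH.
    case: (leqP a (\max_(l <- s | w l == w k) l)) => [le|gt].
      exact: IH.
    by move=> _; exists a; rewrite ?ha ?e ?eqxx.
  apply; last by rewrite -/(kminus w k); lia.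
  apply/allP => i; by rewrite mem_index_iota.
rewrite ei; split => //.
have := occ_count_lt ik (erefl (w k)); have := occ_count_le w (w k) (ub l ltac:(lia) wl).
rewrite ei; lia.
Qed.

Section Occurrences.
Variables (n : nat) (w : nat -> nat).
Hypothesis (hw : index_sequence n w).

Lemma w_in k : (1 <= k)%N -> in_I n (w k).
Proof. by case: hw => H _ _; apply: H. Qed.

Lemma xx_out m c : ~~ in_I n c -> xx w m c = 0.
Proof.
case: (xx_cases w m c) => // -[k [k1 <- _ _]]; by rewrite w_in.
Qed.

Lemma occ_next c N : in_I n c -> exists k, [/\ (1 <= k)%N, (N < k)%N & w k = c].
Proof.
case: hw => _ _ H cI; have [k [k1 wk] lt] := infinite_set_unbounded N (H c cI).
by exists k.
Qed.

Lemma occ_nth c m : in_I n c -> (1 <= m)%N ->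
  exists k, [/\ (1 <= k)%N, w k = c & occ_count w k c = m].
Proof.
move=> cI m1; suff [l] : exists l, (m <= occ_count w l c)%N.
  move=> lm; have [|k [/andP[k1 _] wk ck]] := @occ_count_attained w c m l; first by rewrite m1.
  by exists k.
elim: m {m1} => [|m [l IH]]; first by exists 0%N.
have [k [_ lk wk]] := occ_next l cI; exists k.
by rewrite (leq_ltn_trans IH) ?occ_count_lt.
Qed.

Lemma kplusP k : (1 <= k)%N ->
  [/\ (k < kplus w k)%N, w (kplus w k) = w k,
      occ_count w (kplus w k) (w k) = (occ_count w k (w k)).+1 &
      forall l, (k < l < kplus w k)%N -> w l <> w k].
Proof.
move=> k1; have [m [_ km wm]] := occ_next k (w_in k1).
have Qm : (k < m)%N && (w m == w k) by rewrite km wm eqxx.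
have /andP[lt /eqP e] := @leastP (fun l => (k < l)%N && (w l == w k)) m Qm.
have no l : (k < l < kplus w k)%N -> w l <> w k.
  move=> /andP[kl lk] wl.
  have := @least_min (fun l => (k < l)%N && (w l == w k)) l.
  rewrite kl wl eqxx => /(_ isT); rewrite leqNgt; by rewrite lk.
split => //; have := occ_count_lt lt e; rewrite -/(kplus w k) => lt2.
(* A larger jump of the counter would need an occurrence strictly in between. *)
apply/eqP; rewrite eqn_leq lt2 andbT leqNgt; apply/negP => lt3.
have [|l [/andP[l1 l2] wl cl]] := @occ_count_attained w (w k) (occ_count w k (w k)).+1 (kplus w k).
  by lia.
apply: (no l) => //; apply/andP; split.
  rewrite ltnNge; apply/negP => /(occ_count_le w (w k)); lia.
rewrite ltn_neqAle l2 andbT; apply/eqP => el; move: lt3; rewrite -cl el; lia.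
Qed.

End Occurrences.

(** * Coordinates shifted by P *)
Section ShiftedCoordinates.
Variables (X : cartan_type) (n : nat) (w : nat -> nat).

(** One occurrence of [c] strictly between two positions contributes one
doubly indexed variable. *)
Lemma sum_occ a b c : (a < b)%N -> occ_count w b.-1 c = (occ_count w a c).+1 ->
  \sum_(a.+1 <= j < b | w j == c) x_ j = xx w (occ_count w b.-1 c)%:Z c.
Proof.
move=> ab cb.
have [|k [/andP[k1 k2] wk ck]] := @occ_count_attained w c (occ_count w b.-1 c) b.-1; first by lia.
have ak : (a < k)%N.
  by rewrite ltnNge; apply/negP => /(occ_count_le w c); lia.
rewrite -ck -{3}wk -wk xxE // wk big_nat_cond.
rewrite (eq_bigl (fun j => (a.+1 <= j < b)%N && (j == k))).
  by rewrite -big_nat_cond big_nat1_eq ifT //; lia.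
move=> j; have [/andP[h1 h2]|//] := boolP (a.+1 <= j < b)%N; rewrite /=.
apply/eqP/eqP => [wj|->] //; apply: (occ_count_inj wj wk).
have := occ_count_lt h1 wj; have : (occ_count w j c <= occ_count w b.-1 c)%N by apply: occ_count_le; lia.
lia.
Qed.

Definition shifted_x (c : nat) (t : int) : Qinf_dual := xx w (t + (P_ X n w c)%:Z) c.

(** The time t such that position [k] carries [shifted_x (w k) t]. *)
Definition shifted_pos (k : nat) : int := (occ_count w k (w k))%:Z - (P_ X n w (w k))%:Z.

Lemma coef_shifted_x c t k : (1 <= k)%N ->
  coef (shifted_x c t) k = ((w k == c) && (t == shifted_pos k))%:R.
Proof.
move=> k1; rewrite coef_xx //; case: eqP => // <-; rewrite /shifted_pos.
by congr (_%:R); lia.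
Qed.

Lemma shifted_x_pos k : (1 <= k)%N -> shifted_x (w k) (shifted_pos k) = x_ k.
Proof. by move=> k1; rewrite /shifted_x /shifted_pos subrK xxE. Qed.

Lemma shifted_pos_gt0 k : (1 <= k)%N -> 1 <= shifted_pos k + (P_ X n w (w k))%:Z.
Proof. by move=> k1; rewrite /shifted_pos; have := occ_count_gt0 w k1; lia. Qed.

Lemma P_E k : (X <> TypeD \/ k <> n) -> (k <= n)%N ->
  P_ X n w k = (\sum_(2 <= i < k.+1) p_ w i i.-1)%N.
Proof.
rewrite /P_ => h kn; case: ifP => [_|h2]; last by rewrite big_geq //; lia.
by case: X h => // -[//|/eqP/negbTE ->].
Qed.

Lemma P_succ c : (1 <= c)%N -> (c < n)%N -> (X <> TypeD \/ c.+1 <> n) ->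
  P_ X n w c.+1 = (P_ X n w c + p_ w c.+1 c)%N.
Proof.
move=> c1 cn h; have h' : X <> TypeD \/ c <> n by right; lia.
by rewrite (P_E h) // (P_E h') ?(ltnW cn) // [LHS]big_nat_recr.
Qed.

(** The form B_(c,t): neighbours [e < c] occur one step later than neighbours
[e > c], whatever the sequence is. *)
Definition shifted_beta (c : nat) (t : int) : Qinf_dual :=
  shifted_x c t + shifted_x c (t + 1) + \sum_(1 <= e < n.+1)
     (if e == c then 0 else cartan X n c e)%:~R *: shifted_x e (t + (e < c)%N%:Z).

Hypothesis hw : index_sequence n w.

Lemma shifted_x_out c t : ~~ in_I n c -> shifted_x c t = 0.
Proof. exact: xx_out. Qed.

Lemma shifted_pos_surj c (t : int) : in_I n c -> 1 <= t + (P_ X n w c)%:Z ->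
  exists k, [/\ (1 <= k)%N, w k = c & shifted_pos k = t].
Proof.
move=> cI t1; have [|k [k1 wk ck]] := @occ_nth n w hw c (absz (t + (P_ X n w c)%:Z)) cI.
  by lia.
by exists k; split => //; rewrite /shifted_pos wk ck; lia.
Qed.

Lemma alternates_excl i j : in_I n i -> i <> j ->
  alternates w i j -> ~ alternates w j i.
Proof.
move=> iI ij aij aji.
have [k [k1 _ wk]] := occ_next hw 0%N iI.
have H N := alternates_occ_count N ij aij.
have H' N := alternates_occ_count N (nesym ij) aji.
have := H k; have := H' k; have := H k.-1; have := H' k.-1.
rewrite -(prednK k1) !occ_countS /= (prednK k1) wk eqxx; case: eqP => // _; lia.
Qed.

Hypotheses (hn : valid_rank X n) (had : adapted X n w).

Lemma p_compl i j : in_I n i -> in_I n j -> i <> j -> cartan X n i j <> 0 ->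
  (p_ w i j + p_ w j i = 1)%N.
Proof.
move=> iI jI ij aij; rewrite /p_; case: (had iI jI ij aij) => a.
- rewrite (asboolT a) (asboolF (alternates_excl iI ij a)) //.
- by rewrite (asboolT a) (asboolF (alternates_excl jI (nesym ij) a)).
Qed.

Lemma cartan_sym i j : in_I n i -> in_I n j -> i <> j -> cartan X n i j <> 0 ->
  cartan X n j i <> 0.
Proof.
by case: X hn; rewrite /cartan /adjacent /in_I /valid_rank => hn' iI jI ij;
  repeat case: ifP => //; lia.
Qed.

(** Between two consecutive occurrences of [w k], a neighbour [e] occurs exactly
once, and p_(e,w k) tells whether this occurrence has the number of the
earlier or of the later occurrence of [w k]. *)
Lemma occ_count_between k e : (1 <= k)%N -> in_I n e -> e <> w k ->
  cartan X n (w k) e <> 0 ->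
  occ_count w (kplus w k).-1 e = (occ_count w k (w k) + p_ w e (w k))%N /\
  occ_count w (kplus w k).-1 e = (occ_count w k e).+1.
Proof.
move=> k1 eI ne a; have [lt wk' ck _] := kplusP hw k1.
set k' := kplus w k in lt wk' ck *.
have cS l c : (1 <= l)%N -> occ_count w l c = (occ_count w l.-1 c + (w l == c))%N.
  by move=> l1; rewrite -{1}(prednK l1) occ_countS prednK.
have c1 := cS k (w k) k1; have c2 := cS k e k1.
have c3 := cS k' (w k) ltac:(lia); have c4 := cS k' e ltac:(lia).
move: c1 c2 c3 c4; rewrite wk' eqxx; case: (eqVneq (w k) e) => [/esym//|_].
move=> c1 c2 c3 c4; have wI := w_in hw k1.
have [al|al] := had eI wI ne (cartan_sym wI eI (nesym ne) a).
- rewrite /p_ (asboolT al).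
  have := alternates_occ_count k ne al; have := alternates_occ_count k.-1 ne al.
  have := alternates_occ_count k' ne al; have := alternates_occ_count k'.-1 ne al; lia.
- rewrite /p_ (asboolF (alternates_excl wI (nesym ne) al)).
  have := alternates_occ_count k (nesym ne) al; have := alternates_occ_count k.-1 (nesym ne) al.
  have := alternates_occ_count k' (nesym ne) al; have := alternates_occ_count k'.-1 (nesym ne) al; lia.
Qed.

Lemma beta_sum k : (1 <= k)%N ->
  beta X n w k = x_ k + \sum_(1 <= e < n.+1 | e != w k)
     (cartan X n (w k) e)%:~R *: xx w ((occ_count w k (w k))%:Z + (p_ w e (w k))%:Z) e
   + x_ (kplus w k).
Proof.
move=> k1; rewrite /beta gtn_eqF //; congr (_ + _ + _).
have [lt wk' _ no] := kplusP hw k1.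
(* Group the positions j between k and its successor by their letter e. *)
transitivity (\sum_(k.+1 <= j < kplus w k) \sum_(1 <= e < n.+1 | e == w j)
    (cartan X n (w k) e)%:~R *: x_ j).
  rewrite [LHS]big_nat_cond [RHS]big_nat_cond; apply: eq_bigr => j /andP[/andP[kj _] _].
  by rewrite big_nat1_eq ifT //; have := w_in hw (ltac:(lia) : (1 <= j)%N).
rewrite (exchange_big_dep predT) //= [RHS]big_mkcond.
rewrite [LHS]big_nat_cond [RHS]big_nat_cond; apply: eq_bigr => e /andP[eI _].
rewrite (eq_bigl (fun j => w j == e)); last by move=> j; rewrite eq_sym.
rewrite -scaler_sumr; case: eqP => [->|ne].
  rewrite big_nat_cond big1 ?scaler0 // => j /andP[jr /eqP wj].
  by case: (no j jr).
have [->|a0] := eqVneq (cartan X n (w k) e) 0; first by rewrite !scale0r.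
have [h1 h2] := @occ_count_between k e k1 ltac:(rewrite /in_I; lia) ne (elimN eqP a0).
by rewrite sum_occ // h1 PoszD.
Qed.

Lemma P_Dn : X = TypeD -> P_ X n w n = (P_ X n w (n - 2) + p_ w n (n - 2))%N.
Proof.
move=> XD; have n4 : (4 <= n)%N by move: hn; rewrite XD.
rewrite (@P_E (n - 2)); [|by right; lia|lia]; rewrite /P_ XD eqxx ifT; last by lia.
by have -> : (n - 2).+1 = n.-1 by lia.
Qed.

Lemma cartan_lt c e : in_I n c -> in_I n e -> (e < c)%N -> cartan X n c e <> 0 ->
  (c = e.+1 /\ (X <> TypeD \/ c <> n)) \/ [/\ X = TypeD, c = n & e = (n - 2)%N].
Proof.
rewrite /cartan /adjacent /in_I => cI eI ec; rewrite ifF; last by lia.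
case: X hn; rewrite /valid_rank => hn'.
- case: ifP => // h _; left; split; [lia|by left].
- case: ifP => [h _|h]; first by left; split; [lia|by left].
  by case: ifP => // h' _; left; split; [lia|by left].
- case: ifP => [h _|h]; first by left; split; [lia|by left].
  by case: ifP => // h' _; left; split; [lia|by left].
- case: ifP => // h _; have [en|en] := eqVneq c n; last by left; split; [lia|right; lia].
  right; split => //; lia.
Qed.

(** This is what P is made for: along every edge of the Dynkin diagram it
increases by the corresponding p, also along the edge from n-2 to n in type D. *)
Lemma P_lt c e : in_I n c -> in_I n e -> (e < c)%N -> cartan X n c e <> 0 ->
  P_ X n w c = (P_ X n w e + p_ w c e)%N.
Proof.
move=> cI eI ec a; case: (cartan_lt cI eI ec a) => [[-> h]|[XD -> ->]].
  by move: cI eI; rewrite /in_I => *; apply: P_succ; [lia|lia|case: h; [left|right; lia]].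
exact: P_Dn.
Qed.

(** The term of [e] has index t + P(c) + p_(e,c).  It equals t + P(e) for [e > c],
where P(e) = P(c) + p_(e,c), and t + 1 + P(e) for [e < c], where
P(c) = P(e) + p_(c,e) and p_(e,c) = 1 - p_(c,e). *)
Lemma betaE k : (1 <= k)%N -> beta X n w k = shifted_beta (w k) (shifted_pos k).
Proof.
move=> k1; have [lt wk' ck _] := kplusP hw k1.
rewrite beta_sum // /shifted_beta shifted_x_pos // addrAC; congr (_ + _ + _).
  rewrite /shifted_x -(xxE w (_ : (1 <= kplus w k)%N)) ?wk' ?ck; last by lia.
  by congr (xx w _ _); rewrite /shifted_pos; lia.
rewrite big_mkcond [LHS]big_nat_cond [RHS]big_nat_cond.
apply: eq_bigr => e /andP[eI _]; case: (eqVneq e (w k)) => [|/eqP ne] /=.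
  by rewrite mulr0z scale0r.
have [->|/eqP a0] := eqVneq (cartan X n (w k) e) 0; first by rewrite !scale0r.
congr (_ *: xx w _ _); rewrite /shifted_pos.
have wI := w_in hw k1; have eI' : in_I n e by rewrite /in_I; lia.
have a0' := cartan_sym wI eI' (nesym ne) a0.
have := p_compl wI eI' (nesym ne) a0.
have [lt'|lt'|//] := ltngtP e (w k).
- by have := P_lt wI eI' lt' a0; lia.
- by have := P_lt eI' wI lt' a0'; lia.
Qed.

Lemma beta_minusE k : (1 <= k)%N ->
  beta X n w (kminus w k) = 0 \/ beta X n w (kminus w k) = shifted_beta (w k) (shifted_pos k - 1).
Proof.
move=> k1; case: (kminusP w k1) => [[-> _]|[m1 wm cm]]; first by left; rewrite /beta eqxx.
right; rewrite betaE // wm /shifted_pos wm cm; congr (shifted_beta _ _); lia.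
Qed.

End ShiftedCoordinates.

(** * Letters and the steps between them *)
Fact eqlP : Equality.axiom eql.
Proof.
by move=> [i|i] [j|j] /=; apply: (iffP idP) => //; [move/eqP->|case=> ->|move/eqP->|case=> ->].
Qed.
HB.instance Definition _ := hasDecEq.Build label eqlP.

Lemma eq_PlainPlain i j : (Plain i == Plain j) = (i == j). Proof. by []. Qed.
Lemma eq_BarBar i j : (Bar i == Bar j) = (i == j). Proof. by []. Qed.
Lemma eq_PlainBar i j : (Plain i == Bar j) = false. Proof. by []. Qed.
Lemma eq_BarPlain i j : (Bar i == Plain j) = false. Proof. by []. Qed.
Definition labelE := (eq_PlainPlain, eq_BarBar, eq_PlainBar, eq_BarPlain).

Section Steps.
Variables (X : cartan_type) (n : nat).

(** The columns that are not spin columns have length less than this number.  The nodes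
[c] below it act on letters as in type A: c to c+1, and the bar of c+1 to the
bar of c.  The nodes from it on (n in types B and C, n-1 and n in type D) act on the
letters in the middle of J_X. *)
Definition column_bound : nat := match X with TypeA => n.+1 | TypeD => n.-1 | _ => n end.

(** The two steps of node [c] are [src1 c] to [dst1 c] and [src2 c] to [dst2 c];
the second one is seen [lag c] rows apart from the first.  Where there is no
second step, its letters are chosen outside J_X, so that they never occur. *)
Definition src1 c := if (c < column_bound)%N then Plain c else Plain column_bound.
Definition dst1 c :=
  if (c < column_bound)%N then Plain c.+1
  else if X is TypeD then (if c == n then Bar n else Plain n) else Bar n.
Definition src2 c :=
  if (c < column_bound)%N then Bar c.+1
  else if X is TypeD then (if c == n then Plain n else Bar n) else Plain n.+1.
Definition dst2 c :=
  if (c < column_bound)%N then Bar c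
  else if X is TypeD then Bar column_bound else Plain n.+1.
Definition lag c : int := (column_bound - c)%N%:Z.
Definition mult c : int := if X is TypeC then (if c == n then 2 else 1) else 1.
End Steps.

(** * Boxes and the forms B in shifted coordinates *)
Section BetaTerms.
Variables (X : cartan_type) (n : nat) (w : nat -> nat).
Hypothesis (hw : index_sequence n w).

Local Notation y := (shifted_x X n w).
Local Notation B := (shifted_beta X n w).

(** Three terms suffice since a node has at most three neighbours. *)
Lemma shifted_beta_terms (c : nat) (t a1 a2 a3 : int) (e1 e2 e3 : nat) :
  (forall e, in_I n e -> (if e == c then 0 else cartan X n c e) =
    a1 * (e == e1)%:Z + a2 * (e == e2)%:Z + a3 * (e == e3)%:Z) ->
  B c t = y c t + y c (t + 1) + (a1%:~R *: y e1 (t + (e1 < c)%N%:Z) +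
     a2%:~R *: y e2 (t + (e2 < c)%N%:Z) + a3%:~R *: y e3 (t + (e3 < c)%N%:Z)).
Proof.
move=> H; rewrite /shifted_beta; congr (_ + _ + _).
pose z e := y e (t + (e < c)%N%:Z).
have pick e (a : int) : \sum_(1 <= i < n.+1) (a * (i == e)%:Z)%:~R *: z i = a%:~R *: z e.
  rewrite (eq_bigr (fun i => if i == e then a%:~R *: z i else 0)); last first.
    by move=> i _; case: eqP => _; rewrite ?mulr1 // mulr0 scale0r.
  rewrite -big_mkcond big_nat1_eq; case: ifP => // he.
  by rewrite /z (shifted_x_out X hw) ?scaler0 // /in_I -ltnS he.
rewrite -!pick -!big_split /=; rewrite [LHS]big_nat_cond [RHS]big_nat_cond.
apply: eq_bigr => e /andP[eI _]; rewrite H; last by rewrite /in_I; lia.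
by rewrite -!scalerDl !rmorphD.
Qed.

Lemma xx_shifted_x m c : xx w m c = y c (m - (P_ X n w c)%:Z).
Proof. by rewrite /shifted_x subrK. Qed.

End BetaTerms.

(** Makes equal time arguments of [shifted_x] syntactically equal, so that
[vec_ring] recognizes equal variables. *)
Ltac norm_times := repeat match goal with
  | |- context [shifted_x ?X ?n ?w ?c ?a] => match goal with
    | |- context [shifted_x X n w c ?b] => lazymatch b with a => fail | _ =>
        rewrite (_ : shifted_x X n w c b = shifted_x X n w c a); [|congr (shifted_x _ _ _ _ _); lia] end end end.

Section BoxesByType.
Variables (n : nat) (w : nat -> nat).

Lemma boxAE j s : boxA n w (Plain j) s = shifted_x TypeA n w j s - shifted_x TypeA n w j.-1 (s + 1).
Proof. by rewrite /boxA !(xx_shifted_x TypeA n); norm_times. Qed.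

Lemma boxBE j s : boxB n w (Plain j) s = shifted_x TypeB n w j s - shifted_x TypeB n w j.-1 (s + 1).
Proof. by rewrite /boxB !(xx_shifted_x TypeB n); norm_times. Qed.

Lemma boxB_barE j s : boxB n w (Bar j) s =
   shifted_x TypeB n w j.-1 (s + n%:Z - j%:Z + 1) - shifted_x TypeB n w j (s + n%:Z - j%:Z + 1).
Proof. by rewrite /boxB !(xx_shifted_x TypeB n); norm_times. Qed.

Lemma boxCE j s : boxC n w (Plain j) s =
   shifted_x TypeC n w j s *+ (if j == n then 2 else 1) - shifted_x TypeC n w j.-1 (s + 1).
Proof. by rewrite /boxC; case: eqP => [->|_]; rewrite !(xx_shifted_x TypeC n); norm_times. Qed.

Lemma boxC_barE j s : (j <= n)%N -> boxC n w (Bar j) s =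
   shifted_x TypeC n w j.-1 (s + n%:Z - j%:Z + 1)
   - shifted_x TypeC n w j (s + n%:Z - j%:Z + 1) *+ (if j == n then 2 else 1).
Proof.
move=> jn; rewrite /boxC ifF; last by lia.
by case: eqP => [->|_]; rewrite !(xx_shifted_x TypeC n); norm_times.
Qed.

Lemma boxDE j s : boxD n w (Plain j) s =
   if j == n.-1 then shifted_x TypeD n w j s + shifted_x TypeD n w n s - shifted_x TypeD n w (n - 2) (s + 1)
   else shifted_x TypeD n w j s - shifted_x TypeD n w j.-1 (s + 1).
Proof. by rewrite /boxD; case: eqP => [->|_]; rewrite !(xx_shifted_x TypeD n); norm_times. Qed.

Lemma boxD_barE j s : (j <= n)%N -> boxD n w (Bar j) s =
   if j == n then shifted_x TypeD n w n.-1 s - shifted_x TypeD n w n (s + 1)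
   else if j == n.-1 then
     shifted_x TypeD n w (n - 2) (s + 1) - shifted_x TypeD n w j (s + 1) - shifted_x TypeD n w n (s + 1)
   else shifted_x TypeD n w j.-1 (s + n%:Z - j%:Z) - shifted_x TypeD n w j (s + n%:Z - j%:Z).
Proof.
move=> jn; rewrite /boxD ifF; last by lia.
by case: eqP => [_|_]; [|case: eqP => [->|_]]; rewrite !(xx_shifted_x TypeD n); norm_times.
Qed.
Hypothesis hw : index_sequence n w.

Lemma shifted_betaA c t : (1 <= c <= n)%N -> shifted_beta TypeA n w c t =
  shifted_x TypeA n w c t + shifted_x TypeA n w c (t + 1) - shifted_x TypeA n w c.-1 (t + 1) - shifted_x TypeA n w c.+1 t.
Proof.
move=> cI; rewrite (@shifted_beta_terms _ _ _ hw _ _ (-1) (-1) 0 c.-1 c.+1 0).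
  have [-> ->] : (c.-1 < c)%N = true /\ (c.+1 < c)%N = false by lia.
  rewrite addr0; vec_ring.
by move=> e; rewrite /in_I /cartan /adjacent; repeat case: ifP => ?; lia.
Qed.

Lemma shifted_betaB c t : (1 <= c <= n)%N -> shifted_beta TypeB n w c t =
  shifted_x TypeB n w c t + shifted_x TypeB n w c (t + 1)
  - shifted_x TypeB n w c.-1 (t + 1) *+ (if c == n then 2 else 1) - shifted_x TypeB n w c.+1 t.
Proof.
move=> cI; rewrite (@shifted_beta_terms _ _ _ hw _ _ (if c == n then -2 else -1) (-1) 0 c.-1 c.+1 0).
  have [-> ->] : (c.-1 < c)%N = true /\ (c.+1 < c)%N = false by lia.
  rewrite addr0; case: ifP => _; vec_ring.
by move=> e; rewrite /in_I /cartan /adjacent; repeat case: ifP => ?; lia.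
Qed.

Lemma shifted_betaC c t : (1 <= c <= n)%N -> shifted_beta TypeC n w c t =
  shifted_x TypeC n w c t + shifted_x TypeC n w c (t + 1)
  - shifted_x TypeC n w c.-1 (t + 1) - shifted_x TypeC n w c.+1 t *+ (if c.+1 == n then 2 else 1).
Proof.
move=> cI; rewrite (@shifted_beta_terms _ _ _ hw _ _ (-1) (if c.+1 == n then -2 else -1) 0 c.-1 c.+1 0).
  have [-> ->] : (c.-1 < c)%N = true /\ (c.+1 < c)%N = false by lia.
  rewrite addr0; case: ifP => _; vec_ring.
by move=> e; rewrite /in_I /cartan /adjacent; repeat case: ifP => ?; lia.
Qed.

Lemma shifted_betaD c t : (4 <= n)%N -> (1 <= c <= n)%N -> shifted_beta TypeD n w c t =
  shifted_x TypeD n w c t + shifted_x TypeD n w c (t + 1) -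
  (if c == n then shifted_x TypeD n w (n - 2) (t + 1)
   else if c == n.-1 then shifted_x TypeD n w (n - 2) (t + 1)
   else if c == (n - 2)%N then shifted_x TypeD n w c.-1 (t + 1) + shifted_x TypeD n w n.-1 t + shifted_x TypeD n w n t
   else shifted_x TypeD n w c.-1 (t + 1) + shifted_x TypeD n w c.+1 t).
Proof.
move=> n4 cI; have [->|cn] := eqVneq c n.
  rewrite (@shifted_beta_terms _ _ _ hw _ _ (-1) 0 0 (n - 2)%N 0 0).
    have -> : (n - 2 < n)%N = true by lia.
    vec_ring.
  by move=> e; rewrite /in_I /cartan /adjacent; repeat case: ifP => ?; lia.
have [->|cn1] := eqVneq c n.-1.
  rewrite (@shifted_beta_terms _ _ _ hw _ _ (-1) 0 0 (n - 2)%N 0 0).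
    have -> : (n - 2 < n.-1)%N = true by lia.
    vec_ring.
  by move=> e; rewrite /in_I /cartan /adjacent; repeat case: ifP => ?; lia.
have [->|cn2] := eqVneq c (n - 2)%N.
  rewrite (@shifted_beta_terms _ _ _ hw _ _ (-1) (-1) (-1) (n - 2).-1 n.-1 n).
    have [-> -> ->] : [/\ ((n - 2).-1 < n - 2)%N = true, (n.-1 < n - 2)%N = false
         & (n < n - 2)%N = false] by split; lia.
    rewrite addr0; vec_ring.
  by move=> e; rewrite /in_I /cartan /adjacent; repeat case: ifP => ?; lia.
rewrite (@shifted_beta_terms _ _ _ hw _ _ (-1) (-1) 0 c.-1 c.+1 0).
  have [-> ->] : (c.-1 < c)%N = true /\ (c.+1 < c)%N = false by lia.
  rewrite addr0; vec_ring.
by move=> e; rewrite /in_I /cartan /adjacent; repeat case: ifP => ?; lia.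
Qed.
End BoxesByType.

Section BoxSteps.
Variables (X : cartan_type) (n : nat) (w : nat -> nat).
Hypotheses (hn : valid_rank X n) (hw : index_sequence n w).

Local Notation y := (shifted_x X n w).
Local Notation B := (shifted_beta X n w).

Lemma box_step1 c s : in_I n c ->
  box X n w (src1 X n c) s - box X n w (dst1 X n c) s = (mult X n c)%:~R *: B c s.
Proof.
rewrite /in_I /src1 /dst1 /mult => cI; case: X hn => hn' /=.
- have -> : (c < n.+1)%N by lia.
  by rewrite !boxAE shifted_betaA //=; vec_ring.
- have [lt|ge] := ltnP c n.
    by rewrite !boxBE shifted_betaB //= ifF; [vec_ring|lia].
  have -> : c = n by lia.
  rewrite boxBE boxB_barE shifted_betaB ?eqxx; [|done|lia].
  rewrite (shifted_x_out _ hw (c := n.+1)); last by rewrite /in_I; lia.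
  norm_times; vec_ring.
- have [lt|ge] := ltnP c n.
    have cn : (c == n) = false by lia.
    rewrite !boxCE shifted_betaC //= cn; case: (c.+1 == n); vec_ring.
  have -> : c = n by lia.
  rewrite boxCE boxC_barE // shifted_betaC ?eqxx; [|done|lia].
  rewrite (shifted_x_out _ hw (c := n.+1)); last by rewrite /in_I; lia.
  have -> : (n.+1 == n) = false by lia.
  norm_times; vec_ring.
- have nn : (n.-1 == n) = false by lia.
  have [lt|ge] := ltnP c n.-1.
    have c1 : (c == n) = false by lia.
    have c2 : (c == n.-1) = false by lia.
    rewrite !boxDE shifted_betaD //= c1 c2.
    have [e|ne] := eqVneq c (n - 2)%N.
      have -> : c.+1 = n.-1 by lia.
      rewrite eqxx -e; vec_ring.
    have -> : (c.+1 == n.-1) = false by lia.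
    by vec_ring.
  have [->|ne] := eqVneq c n.
    rewrite boxDE boxD_barE // shifted_betaD //; last by lia.
    rewrite !eqxx; norm_times; vec_ring.
  have -> : c = n.-1 by lia.
  rewrite !boxDE shifted_betaD //; last by lia.
  rewrite !eqxx nn [n == n.-1]eq_sym nn; vec_ring.
Qed.

Lemma box_step2 c s : in_I n c -> in_J X n (src2 X n c) ->
  box X n w (src2 X n c) s - box X n w (dst2 X n c) s
  = (mult X n c)%:~R *: B c (s + lag X n c).
Proof.
rewrite /in_I /src2 /dst2 /mult /lag => cI; case: X hn => hn' /=.
- by rewrite ifT //; lia.
- have [lt|ge] := ltnP c n; last by rewrite /=; lia.
  move=> _; rewrite !boxB_barE shifted_betaB //= ifF; last by lia.
  norm_times; vec_ring.
- have [lt|ge] := ltnP c n; last by rewrite /=; lia.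
  move=> _; rewrite !boxC_barE ?shifted_betaC //=; [|lia].
  have -> : (c == n) = false by lia.
  case: (c.+1 == n); norm_times; vec_ring.
- have nn : (n.-1 == n) = false by lia.
  have [lt|ge] := ltnP c n.-1; move=> _.
    have c1 : (c == n) = false by lia.
    have c2 : (c == n.-1) = false by lia.
    have c3 : (c.+1 == n) = false by lia.
    rewrite !boxD_barE ?shifted_betaD //=; [|lia|lia]; rewrite c1 c2 c3.
    have [e|ne] := eqVneq c (n - 2)%N.
      have -> : c.+1 = n.-1 by lia.
      rewrite eqxx -e; norm_times; vec_ring.
    have -> : (c.+1 == n.-1) = false by lia.
    norm_times; vec_ring.
  have [->|ne] := eqVneq c n.
    rewrite boxDE boxD_barE ?shifted_betaD //; [|lia|lia].
    rewrite !eqxx nn [n == n.-1]eq_sym nn; norm_times; vec_ring.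
  have -> : c = n.-1 by lia.
  rewrite !boxD_barE ?shifted_betaD //; [|lia|lia].
  rewrite !eqxx nn; norm_times; vec_ring.
Qed.

(** The steps also describe the coefficients of a box: they are positive at the
nodes and times where its letter can be raised, and negative, one unit of time
later, where it can be lowered. *)
Lemma coef_box a s k : in_J X n a -> (1 <= k)%N ->
  coef (box X n w a s) k = (mult X n (w k) *
   (((a == src1 X n (w k)) && (shifted_pos X n w k == s))%:Z
   - ((a == dst1 X n (w k)) && (shifted_pos X n w k == s + 1))%:Z
   + ((a == src2 X n (w k)) && (shifted_pos X n w k == s + lag X n (w k)))%:Z
   - ((a == dst2 X n (w k)) && (shifted_pos X n w k == s + lag X n (w k) + 1))%:Z))%:~R.
Proof.
move=> aJ k1; have := w_in hw k1; have := fun c t => @coef_shifted_x X n w c t k k1.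
move: (shifted_pos X n w k) => t; move: (w k) => c cy.
rewrite /in_I /src1 /dst1 /src2 /dst2 /mult /lag; move: hn aJ; case: X cy => cy hn' /=.
- case: a => [j|//] jJ cI; rewrite boxAE !coefE !cy !pmulrn -!rmorphB; congr (_%:~R).
  have -> : (c < n.+1)%N by lia.
  by rewrite ?labelE; lia.
- case: a => j; move=> jJ cI; rewrite /= in jJ; [rewrite boxBE|rewrite boxB_barE];
    rewrite !coefE !cy !pmulrn -!rmorphB; congr (_%:~R);
    by repeat case: ifP => ?; rewrite ?labelE; lia.
- case: a => j; move=> jJ cI; rewrite /= in jJ; [rewrite boxCE|rewrite boxC_barE];
    rewrite ?coefE ?cy ?pmulrn -?mulrzA -?rmorphB; [congr (_%:~R)|congr (_%:~R)|by lia];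
    by repeat case: ifP => ?; rewrite ?labelE; lia.
- case: a => j; move=> jJ cI; rewrite /= in jJ; [rewrite boxDE|rewrite boxD_barE; last by lia].
    case: (eqVneq j n.-1) => [ej|ne]; rewrite !coefE !cy !pmulrn -?intrD -!intrB;
      congr (_%:~R); by repeat case: ifP => ?; rewrite ?labelE; lia.
  case: (eqVneq j n) => [ej|ne]; [|case: (eqVneq j n.-1) => [ej|ne']];
    rewrite !coefE !cy !pmulrn -!rmorphB; congr (_%:~R);
    by repeat case: ifP => ?; rewrite ?labelE; lia.
Qed.
End BoxSteps.

(** * Columns, read from the bottom *)

(** The letter at depth [q], counted from the bottom.  Outside the column the
default letters Bar 0 (below) and Plain 0 (above) are larger and smaller than all
letters of J_X, so that the order conditions need no boundary cases. *)
Definition entry (rs : seq label) (q : int) : label :=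
  if q is Posz m then nth (Plain 0) rs m else Bar 0.

Lemma entry_neg rs q : q < 0 -> entry rs q = Bar 0.
Proof. by case: q. Qed.

Lemma entry_big rs q : (size rs)%:Z <= q -> entry rs q = Plain 0.
Proof. by case: q => // m h; rewrite /entry nth_default //; lia. Qed.

Lemma entry_cons a rs q : entry (a :: rs) q = if q == 0 then a else entry rs (q - 1).
Proof.
case: q => [[|m]|m]; [by []| |by rewrite [RHS]/= entry_neg //; lia].
by have -> : m.+1%:Z - 1 = m by lia.
Qed.

Lemma entry_cat r1 r2 q : entry (r1 ++ r2) q =
  if q < (size r1)%:Z then entry r1 q else entry r2 (q - (size r1)%:Z).
Proof.
case: q => [m|m]; last by [].
rewrite /= nth_cat ltz_nat; case: ltnP => h //.
by have -> : m%:Z - (size r1)%:Z = (m - size r1)%N%:Z by lia.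
Qed.

Definition set_entry (rs : seq label) (q : int) (x : label) : seq label :=
  set_nth (Plain 0) rs (absz q) x.

Lemma size_set_entry rs q x : 0 <= q < (size rs)%:Z -> size (set_entry rs q x) = size rs.
Proof. by move=> h; rewrite size_set_nth; apply/maxn_idPr; lia. Qed.

Lemma entry_set_entry rs q x q' : 0 <= q < (size rs)%:Z ->
  entry (set_entry rs q x) q' = if q' == q then x else entry rs q'.
Proof.
move=> h; case: q' => [m|m] /=; last by rewrite ifF //; lia.
by rewrite nth_set_nth /=; congr (if _ then _ else _); lia.
Qed.

(** [a] may stand directly above [b].  In types A, B, C this is the strict order
([nd_ltJ]); in type D, n and its bar may stand above each other. *)
Definition nd X n (a b : label) := ~~ leJ X n b a.

(** The order condition from depth -1 to [size rs] includes the default letters;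
for letters of J_X these two instances hold automatically ([columnP]). *)
Definition column X n (rs : seq label) : Prop :=
  (forall q, 0 <= q < (size rs)%:Z -> in_J X n (entry rs q)) /\
  (forall q, -1 <= q < (size rs)%:Z -> nd X n (entry rs (q + 1)) (entry rs q)).

Lemma column_in X n rs : column X n rs -> all (in_J X n) rs.
Proof.
move=> [h _]; apply/(all_nthP (Plain 0)) => i hi; apply: (h i); lia.
Qed.

Lemma nd_bars X n i j : nd X n (Bar j) (Bar i) = (i < j)%N.
Proof. by rewrite /nd /leJ /=; lia. Qed.

Lemma nd_bot X n a : in_J X n a -> nd X n a (Bar 0).
Proof. by rewrite /nd /leJ; case: a => j; case: X => //=; lia. Qed.

Lemma nd_top X n a : in_J X n a -> nd X n (Plain 0) a.
Proof. by rewrite /nd /leJ; case: a => j; case: X => //=; lia. Qed.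

Lemma nd_top_bot X n : valid_rank X n -> nd X n (Plain 0) (Bar 0).
Proof. by rewrite /nd /leJ; case: X => //=; lia. Qed.

Lemma columnP X n rs : valid_rank X n ->
  (column X n rs <-> all (in_J X n) rs && sorted (nd X n) (rev rs)).
Proof.
move=> hn; rewrite rev_sorted; split.
  move=> hc; rewrite (column_in hc) /=; case: hc => _ h.
  apply/(sortedP (Plain 0)) => i hi; have := h i ltac:(lia).
  by have -> : i%:Z + 1 = i.+1 by lia.
move=> /andP[/(all_nthP (Plain 0)) hJ /(sortedP (Plain 0)) hS]; split.
  by case=> // m hm; apply: hJ; lia.
move=> q hq; have [e|ne] := eqVneq q (-1).
  rewrite e [entry _ (-1)]entry_neg // addrC subrr.
  have hJ0 : (0 < size rs)%N -> in_J X n (entry rs 0) by move=> h; apply: hJ.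
  have h0 : size rs = 0%N -> entry rs 0 = Plain 0 by move=> h; rewrite entry_big ?h.
  have [z0|/hJ0 h] := posnP (size rs).
    by rewrite h0 //; apply: nd_top_bot.
  exact: nd_bot.
have [e|lt] := eqVneq q ((size rs)%:Z - 1).
  rewrite {1}e subrK entry_big //.
  have : in_J X n (entry rs q) by case: q hq ne e => m hq ne e; [apply: hJ|exfalso]; lia.
  exact: nd_top.
case: q hq ne lt => [m|m] hq ne lt; last by exfalso; lia.
have -> : m%:Z + 1 = m.+1 by lia.
by apply: hS; lia.
Qed.

(** * Order conditions under a step *)
Section Labels.
Variables (X : cartan_type) (n : nat).
Hypothesis hn : valid_rank X n.
Local Notation nd := (nd X n).

Ltac unfold_steps := rewrite /in_I /src1 /dst1 /src2 /dst2 /column_bound /nd /leJ /in_J.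
Ltac decide_labels := repeat case: ifP => ?; rewrite /= ?labelE; lia.

Lemma step_proper c : in_I n c ->
  [/\ src1 X n c \notin [:: Plain 0; Bar 0], dst1 X n c \notin [:: Plain 0; Bar 0],
      src2 X n c \notin [:: Plain 0; Bar 0] & dst2 X n c \notin [:: Plain 0; Bar 0]].
Proof.
rewrite /in_I /src1 /dst1 /src2 /dst2 /column_bound; case: X hn => /= hn' cI; split;
  repeat case: ifP => ?; rewrite !inE !labelE; lia.
Qed.

Lemma step1_in c : in_I n c -> in_J X n (src1 X n c) /\ in_J X n (dst1 X n c).
Proof.
rewrite /in_I /src1 /dst1 /column_bound; case: X hn => /= hn' cI; split;
  repeat case: ifP => ?; rewrite /=; lia.
Qed.

Lemma step2_in c : in_I n c -> in_J X n (src2 X n c) = in_J X n (dst2 X n c).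
Proof.
by rewrite /in_I /src2 /dst2 /column_bound; case: X hn => /= hn' cI;
  repeat case: ifP => ?; rewrite /=; lia.
Qed.

(** Moving the lower letter up or the upper letter down preserves the order. *)
Lemma nd_up1 c z : in_I n c -> nd z (src1 X n c) -> nd z (dst1 X n c).
Proof.
unfold_steps; case: X hn => /= hn' cI; case: z => j; decide_labels.
Qed.

Lemma nd_up2 c z : in_I n c -> nd z (src2 X n c) -> nd z (dst2 X n c).
Proof.
unfold_steps; case: X hn => /= hn' cI; case: z => j; decide_labels.
Qed.

Lemma nd_dn1 c z : in_I n c -> nd (dst1 X n c) z -> nd (src1 X n c) z.
Proof.
unfold_steps; case: X hn => /= hn' cI; case: z => j; decide_labels.
Qed.

Lemma nd_dn2 c z : in_I n c -> nd (dst2 X n c) z -> nd (src2 X n c) z.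
Proof.
unfold_steps; case: X hn => /= hn' cI; case: z => j; decide_labels.
Qed.

(** The only letter that blocks raising the source of a step is its target, just
below.  In type D, at the nodes n-1 and n, n and its bar are incomparable, and the
target of the first step blocks the second step as well. *)
Lemma nd_raise1 c z : in_I n c -> in_J X n z || (z == Bar 0) ->
  nd (src1 X n c) z -> z != dst1 X n c -> nd (dst1 X n c) z.
Proof.
unfold_steps; case: X hn => /= hn' cI; case: z => j; decide_labels.
Qed.

Lemma nd_raise2 c z : in_I n c -> in_J X n (src2 X n c) -> in_J X n z || (z == Bar 0) ->
  nd (src2 X n c) z -> z != dst2 X n c -> ((column_bound X n <= c)%N ==> (z != dst1 X n c)) ->
  nd (dst2 X n c) z.
Proof.
unfold_steps; case: X hn => /= hn' cI; case: z => j; decide_labels.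
Qed.

Lemma nd_lower1 c z : in_I n c -> in_J X n z || (z == Plain 0) ->
  nd z (dst1 X n c) -> z != src1 X n c -> ((column_bound X n <= c)%N ==> (z != src2 X n c)) ->
  nd z (src1 X n c).
Proof.
unfold_steps; case: X hn => /= hn' cI; case: z => j; decide_labels.
Qed.

Lemma nd_lower2 c z : in_I n c -> in_J X n (src2 X n c) -> in_J X n z || (z == Plain 0) ->
  nd z (dst2 X n c) -> z != src2 X n c -> nd z (src2 X n c).
Proof.
unfold_steps; case: X hn => /= hn' cI; case: z => j; decide_labels.
Qed.

End Labels.

(** * Raising and lowering one letter of a column *)
Section Moves.
Variables (X : cartan_type) (n : nat) (w : nat -> nat).

Local Notation y := (shifted_x X n w).
Local Notation B := (shifted_beta X n w).
Local Notation nd := (nd X n).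
Local Notation bx := (box X n w).
Local Notation mult := (mult X n).
Local Notation lag := (lag X n).

Fixpoint column_sum (rs : seq label) (s : int) : Qinf_dual :=
  if rs is a :: r then bx a s + column_sum r (s + 1) else 0.

Lemma column_sum_cat r1 r2 s : column_sum (r1 ++ r2) s = column_sum r1 s + column_sum r2 (s + (size r1)%:Z).
Proof.
elim: r1 s => [|a r IH] s /=; first by rewrite addr0 add0r.
by rewrite IH addrA; congr (_ + column_sum _ _); lia.
Qed.

Lemma column_sum_rcons rs a s : column_sum (rcons rs a) s = column_sum rs s + bx a (s + (size rs)%:Z).
Proof. by rewrite -cats1 column_sum_cat; congr (_ + _); exact: addr0. Qed.

Lemma column_sum_set_entry rs q x s : 0 <= q < (size rs)%:Z ->
  column_sum (set_entry rs q x) s = column_sum rs s - bx (entry rs q) (s + q) + bx x (s + q).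
Proof.
case: q => // m; rewrite /set_entry /= => hm; have {}hm : (m < size rs)%N by lia.
elim: rs m s hm => [|a r IH] [|m] s //= hm; first by rewrite addr0; vec_ring.
rewrite IH //; have -> : s + 1 + m%:Z = s + m.+1%:Z by lia.
by vec_ring.
Qed.

(** Excluding the default letters makes occurrences additive along the column. *)
Lemma entry_cons_eq a rs x q : x \notin [:: Plain 0; Bar 0] ->
  (entry (a :: rs) q == x)%:Z = ((a == x) && (q == 0))%:Z + (entry rs (q - 1) == x)%:Z.
Proof.
rewrite !inE negb_or => /andP[h1 h2]; rewrite entry_cons; have [->|_] := eqVneq q 0.
  by rewrite entry_neg // (eq_sym (Bar 0)) (negbTE h2) andbT addr0.
by rewrite andbF add0r.
Qed.

Lemma entry_range rs q x : x \notin [:: Plain 0; Bar 0] -> entry rs q = x ->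
  0 <= q < (size rs)%:Z.
Proof.
move=> hx e; apply/negP => /negP; rewrite negb_and -ltNge -leNgt => /orP[h|h]; move: hx.
- by rewrite -e entry_neg.
- by rewrite -e entry_big.
Qed.

Lemma column_set_entry rs q x : column X n rs -> 0 <= q < (size rs)%:Z -> in_J X n x ->
  nd (entry rs (q + 1)) x -> nd x (entry rs (q - 1)) -> column X n (set_entry rs q x).
Proof.
move=> [h1 h2] hq xJ n1 n2; split => q'; rewrite size_set_entry // => hq'.
  by rewrite entry_set_entry //; case: eqP => // _; apply: h1.
rewrite !entry_set_entry //; case: eqP => [e1|ne1]; case: eqP => [e2|ne2].
- lia.
- by have -> : q' = q - 1 by lia.
- by rewrite e2.
- exact: h2.
Qed.

Lemma column_below rs q : column X n rs -> 0 <= q < (size rs)%:Z ->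
  in_J X n (entry rs (q - 1)) || (entry rs (q - 1) == Bar 0).
Proof.
move=> [h _] hq; have [h0|h0] := ltP (q - 1) 0; first by rewrite entry_neg // eqxx orbT.
by rewrite h //; lia.
Qed.

Lemma column_above rs q : column X n rs -> 0 <= q < (size rs)%:Z ->
  in_J X n (entry rs (q + 1)) || (entry rs (q + 1) == Plain 0).
Proof.
move=> [h _] hq; have [h0|h0] := leP (size rs)%:Z (q + 1).
  by rewrite entry_big // eqxx orbT.
by rewrite h //; lia.
Qed.

Hypotheses (hn : valid_rank X n) (hw : index_sequence n w).

Lemma coef_column_sum rs s k : all (in_J X n) rs -> (1 <= k)%N ->
  let q := shifted_pos X n w k - s in let c := w k in
  coef (column_sum rs s) k = (mult c *
   ((entry rs q == src1 X n c)%:Z - (entry rs (q - 1) == dst1 X n c)%:Z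
   + (entry rs (q - lag c) == src2 X n c)%:Z
   - (entry rs (q - lag c - 1) == dst2 X n c)%:Z))%:~R.
Proof.
move=> hJ k1 q c; have [p1 p2 p3 p4] := step_proper hn (w_in hw k1).
rewrite {}/q -/c in p1 p2 p3 p4 *; set t := shifted_pos X n w k.
elim: rs s hJ => [|a rs IH] s.
  move=> _; have E x q : x \notin [:: Plain 0; Bar 0] -> (entry [::] q == x) = false.
    rewrite !inE negb_or eq_sym (eq_sym x) => /andP[/negbTE h1 /negbTE h2].
    by case: q => m; [rewrite entry_big|rewrite entry_neg].
  by rewrite !E //= mulr0.
move=> /andP[aJ hJ]; rewrite [column_sum _ _]/= coefD coef_box // IH // -intrD; congr (_%:~R).
rewrite -/c -/t !entry_cons_eq // -mulrDr; congr (_ * _).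
have e1 : t - (s + 1) = t - s - 1 by lia.
rewrite !e1.
have -> : t - s - 1 - lag c = t - s - lag c - 1 by lia.
rewrite (_ : (t == s) = (t - s == 0)); last by lia.
rewrite (_ : (t == s + 1) = (t - s - 1 == 0)); last by lia.
rewrite (_ : (t == s + lag c) = (t - s - lag c == 0)); last by lia.
rewrite (_ : (t == s + lag c + 1) = (t - s - lag c - 1 == 0)); last by lia.
ring.
Qed.

Lemma raise1 rs s q c : in_I n c -> column X n rs ->
  entry rs q = src1 X n c -> entry rs (q - 1) != dst1 X n c ->
  [/\ 0 <= q < (size rs)%:Z, column X n (set_entry rs q (dst1 X n c)) &
   column_sum (set_entry rs q (dst1 X n c)) s = column_sum rs s - (mult c)%:~R *: B c (s + q)].
Proof.
move=> cI hc e ne; have [p1 _ _ _] := step_proper hn cI.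
have hq := entry_range p1 e; have [_ h2] := hc; split => //.
  apply: column_set_entry => //; first by case: (step1_in hn cI).
    by apply: nd_up1 => //; rewrite -e; apply: h2; lia.
  apply: nd_raise1 => //; first exact: column_below.
  by rewrite -e; have := h2 (q - 1); rewrite subrK; apply; lia.
by rewrite column_sum_set_entry // e -box_step1 //; vec_ring.
Qed.

Lemma lower1 rs s q c : in_I n c -> column X n rs ->
  entry rs q = dst1 X n c -> entry rs (q + 1) != src1 X n c ->
  ((column_bound X n <= c)%N ==> (entry rs (q + 1) != src2 X n c)) ->
  [/\ 0 <= q < (size rs)%:Z, column X n (set_entry rs q (src1 X n c)) &
   column_sum (set_entry rs q (src1 X n c)) s = column_sum rs s + (mult c)%:~R *: B c (s + q)].
Proof.
move=> cI hc e ne ne'; have [_ p1 _ _] := step_proper hn cI.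
have hq := entry_range p1 e; have [_ h2] := hc; split => //.
  apply: column_set_entry => //; first by case: (step1_in hn cI).
    apply: nd_lower1 => //; first exact: column_above.
    by rewrite -e; apply: h2; lia.
  apply: nd_dn1 => //.
  by rewrite -e; have := h2 (q - 1); rewrite subrK; apply; lia.
by rewrite column_sum_set_entry // e -box_step1 //; vec_ring.
Qed.

Lemma raise2 rs s q c : in_I n c -> column X n rs ->
  entry rs q = src2 X n c -> entry rs (q - 1) != dst2 X n c ->
  ((column_bound X n <= c)%N ==> (entry rs (q - 1) != dst1 X n c)) ->
  [/\ 0 <= q < (size rs)%:Z, column X n (set_entry rs q (dst2 X n c)) &
   column_sum (set_entry rs q (dst2 X n c)) s = column_sum rs s - (mult c)%:~R *: B c (s + q + lag c)].
Proof.
move=> cI hc e ne ne'; have [_ _ p1 _] := step_proper hn cI.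
have hq := entry_range p1 e; have [h1 h2] := hc.
have lJ : in_J X n (src2 X n c) by rewrite -e; apply: h1.
split => //.
  apply: column_set_entry => //; first by rewrite -step2_in.
    by apply: nd_up2 => //; rewrite -e; apply: h2; lia.
  apply: nd_raise2 => //; first exact: column_below.
  by rewrite -e; have := h2 (q - 1); rewrite subrK; apply; lia.
by rewrite column_sum_set_entry // e -box_step2 //; vec_ring.
Qed.

Lemma lower2 rs s q c : in_I n c -> column X n rs ->
  entry rs q = dst2 X n c -> entry rs (q + 1) != src2 X n c ->
  [/\ 0 <= q < (size rs)%:Z, column X n (set_entry rs q (src2 X n c)) &
   column_sum (set_entry rs q (src2 X n c)) s = column_sum rs s + (mult c)%:~R *: B c (s + q + lag c)].
Proof.
move=> cI hc e ne; have [_ _ _ p1] := step_proper hn cI.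
have hq := entry_range p1 e; have [h1 h2] := hc.
have lJ : in_J X n (src2 X n c) by rewrite step2_in // -e; apply: h1.
split => //.
  apply: column_set_entry => //.
    apply: nd_lower2 => //; first exact: column_above.
    by rewrite -e; apply: h2; lia.
  apply: nd_dn2 => //.
  by rewrite -e; have := h2 (q - 1); rewrite subrK; apply; lia.
by rewrite column_sum_set_entry // e -box_step2 //; vec_ring.
Qed.

End Moves.

(** * Columns are stable under the operators *)
Section Closure.
Variables (X : cartan_type) (n : nat) (w : nat -> nat).
Hypotheses (hn : valid_rank X n) (hw : index_sequence n w) (had : adapted X n w).

Local Notation y := (shifted_x X n w).
Local Notation B := (shifted_beta X n w).
Local Notation bx := (box X n w).
Local Notation shifted_pos := (shifted_pos X n w).
Local Notation mult := (mult X n).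
Local Notation lag := (lag X n).
Local Notation src1 := (src1 X n).
Local Notation dst1 := (dst1 X n).
Local Notation src2 := (src2 X n).
Local Notation dst2 := (dst2 X n).
Local Notation column := (column X n).
Local Notation column_sum := (column_sum X n w).

(** The second condition is asked also at the first occurrence of a letter, where S
does nothing: lowering a letter gives a column whether or not the sequence has
the corresponding position. *)
Definition stable (M : Qinf_dual -> Prop) : Prop := forall phi k, M phi -> (1 <= k)%N ->
  (0 < coef phi k -> M (phi - coef phi k *: B (w k) (shifted_pos k))) /\
  (coef phi k < 0 -> M (phi - coef phi k *: B (w k) (shifted_pos k - 1))).

Lemma stable_S M phi k : stable M -> M phi -> (1 <= k)%N -> M (S_op X n w k phi).
Proof.
move=> sM Mphi k1; have [up dn] := sM phi k Mphi k1; rewrite /S_op.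
case: ltrgt0P => h; first by rewrite betaE //; exact: up.
  have [->|->] := beta_minusE hw hn had k1; last exact: dn.
  by rewrite scaler0 subr0.
by rewrite h scale0r subr0.
Qed.

Lemma mult_gt0 c : 0 < mult c.
Proof. by rewrite /mult; case: X => //; case: ifP. Qed.

Lemma src1_neq_src2 c : in_I n c -> src1 c != src2 c.
Proof.
rewrite /in_I /src1 /src2 /column_bound; case: X hn => /= hn' cI;
  repeat case: ifP => ?; rewrite ?labelE; lia.
Qed.

Lemma dst1_neq_dst2 c : in_I n c -> dst1 c != dst2 c.
Proof.
rewrite /in_I /dst1 /dst2 /column_bound; case: X hn => /= hn' cI;
  repeat case: ifP => ?; rewrite ?labelE; lia.
Qed.

Lemma lag0 c : (column_bound X n <= c)%N -> lag c = 0.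
Proof. by rewrite /lag => h; have -> : (column_bound X n - c = 0)%N by lia. Qed.

Lemma lag_gt0 c : (c < column_bound X n)%N -> 1 <= lag c.
Proof. by rewrite /lag; lia. Qed.

(** The coefficient of a column at node [c], divided by [mult c]; [q] is the depth
of the first step. *)
Definition excess rs c q : int :=
  (entry rs q == src1 c)%:Z - (entry rs (q - 1) == dst1 c)%:Z
  + (entry rs (q - lag c) == src2 c)%:Z - (entry rs (q - lag c - 1) == dst2 c)%:Z.

(** Each step contributes 1, 0 or -1 to the excess.  If the excess is 1, one step
contributes 1 and the other 0, and raising the first one is enough; if it is 2,
both are raised, and they do not interfere because the two steps of a node below
[column_bound] involve different letters and different depths. *)
Lemma column_raise rs s q c : in_I n c -> column rs -> 0 < excess rs c q ->
  exists rs', [/\ column rs', size rs' = size rs &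
    column_sum rs' s = column_sum rs s - (mult c * excess rs c q)%:~R *: B c (s + q)].
Proof.
rewrite /excess => cI hc.
have n12 := src1_neq_src2 cI; have h12 := dst1_neq_dst2 cI.
(* Only the combinations with an excess of the right sign survive. *)
have [a|a] := eqVneq (entry rs q) (src1 c); have [b|b] := eqVneq (entry rs (q - 1)) (dst1 c);
have [c'|c'] := eqVneq (entry rs (q - lag c)) (src2 c);
have [d|d] := eqVneq (entry rs (q - lag c - 1)) (dst2 c) => //= _.
- have [|hq h1 h2] := raise2 hn hw s cI hc c' d.
    apply/implyP => /lag0 o0; move: c' n12; rewrite o0 subr0 a => <-; by rewrite eqxx.
  exists (set_entry rs (q - lag c) (dst2 c)); split; rewrite ?size_set_entry // h2 mulr1.
  by congr (_ - _ *: B c _); lia.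
- have [hq h1 h2] := raise1 hn hw s cI hc a b.
  by exists (set_entry rs q (dst1 c)); split; rewrite ?size_set_entry // h2 mulr1.
- have [le|lt] := leqP (column_bound X n) c.
    by move: c' n12; rewrite lag0 // subr0 a => <-; rewrite eqxx.
  have o1 := lag_gt0 lt.
  have [hq h1 h2] := raise1 hn hw s cI hc a b.
  have [] := @raise2 X n w hn hw (set_entry rs q (dst1 c)) s (q - lag c) c cI h1.
  + by rewrite entry_set_entry // ifF //; lia.
  + by rewrite entry_set_entry // ifF //; lia.
  + by apply/implyP; lia.
  move=> hq' h1' h2'; exists (set_entry (set_entry rs q (dst1 c)) (q - lag c) (dst2 c)).
  split => //; first by rewrite (size_set_entry _ hq') (size_set_entry _ hq).
  rewrite h2' h2 rmorphM /=.
  have -> : s + (q - lag c) + lag c = s + q by lia.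
  by vec_ring.
- have [hq h1 h2] := raise1 hn hw s cI hc a b.
  by exists (set_entry rs q (dst1 c)); split; rewrite ?size_set_entry // h2 mulr1.
- have [|hq h1 h2] := raise2 hn hw s cI hc c' d.
    by apply/implyP => /lag0 o0; rewrite o0 subr0.
  exists (set_entry rs (q - lag c) (dst2 c)); split; rewrite ?size_set_entry // h2 mulr1.
  by congr (_ - _ *: B c _); lia.
Qed.

Lemma column_lower rs s q c : in_I n c -> column rs -> excess rs c q < 0 ->
  exists rs', [/\ column rs', size rs' = size rs &
    column_sum rs' s = column_sum rs s - (mult c * excess rs c q)%:~R *: B c (s + q - 1)].
Proof.
rewrite /excess => cI hc.
have n12 := src1_neq_src2 cI; have h12 := dst1_neq_dst2 cI.
have E1 : s + q - 1 = s + (q - 1) by lia.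
have E2 : s + q - 1 = s + (q - lag c - 1) + lag c by lia.
have E3 : q - lag c - 1 + 1 = q - lag c by lia.
(* Only the combinations with an excess of the right sign survive. *)
have [a|a] := eqVneq (entry rs q) (src1 c); have [b|b] := eqVneq (entry rs (q - 1)) (dst1 c);
have [c'|c'] := eqVneq (entry rs (q - lag c)) (src2 c);
have [d|d] := eqVneq (entry rs (q - lag c - 1)) (dst2 c) => //= _.
- have [|hq h1 h2] := lower2 hn hw s cI hc d; first by rewrite E3.
  exists (set_entry rs (q - lag c - 1) (src2 c)); split; rewrite ?size_set_entry // h2 -E2.
  by vec_ring.
- have [| |hq h1 h2] := lower1 hn hw s cI hc b; rewrite ?subrK //.
    by apply/implyP => /lag0 o0; move: d h12; rewrite o0 subr0 b => ->; rewrite eqxx.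
  exists (set_entry rs (q - 1) (src1 c)); split; rewrite ?size_set_entry // h2 -E1.
  by vec_ring.
- have [le|lt] := leqP (column_bound X n) c.
    by move: d h12; rewrite lag0 // subr0 b => ->; rewrite eqxx.
  have o1 := lag_gt0 lt.
  have [| |hq h1 h2] := lower1 hn hw s cI hc b; rewrite ?subrK //.
    by apply/implyP; lia.
  have [] := @lower2 X n w hn hw (set_entry rs (q - 1) (src1 c)) s (q - lag c - 1) c cI h1.
  + by rewrite entry_set_entry // ifF //; lia.
  + by rewrite entry_set_entry // E3; case: ifP.
  move=> hq' h1' h2'; exists (set_entry (set_entry rs (q - 1) (src1 c)) (q - lag c - 1) (src2 c)).
  split => //; first by rewrite (size_set_entry _ hq') (size_set_entry _ hq).
  rewrite h2' h2 -E2 -E1.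
  by vec_ring.
- have [| |hq h1 h2] := lower1 hn hw s cI hc b; rewrite ?subrK //.
    by apply/implyP => /lag0 o0; move: c'; rewrite o0 subr0.
  exists (set_entry rs (q - 1) (src1 c)); split; rewrite ?size_set_entry // h2 -E1.
  by vec_ring.
- have [|hq h1 h2] := lower2 hn hw s cI hc d; first by rewrite E3.
  exists (set_entry rs (q - lag c - 1) (src2 c)); split; rewrite ?size_set_entry // h2 -E2.
  by vec_ring.
Qed.

Definition column_set (m : nat) (s : int) (phi : Qinf_dual) : Prop :=
  exists rs, [/\ column rs, size rs = m & phi = column_sum rs s].

Lemma stable_column m s : stable (column_set m s).
Proof.
move=> phi k [rs [hc sz ->]] k1; have cI := w_in hw k1; have m0 := mult_gt0 (w k).
have := coef_column_sum hn hw s (column_in hc) k1; set q := shifted_pos k - s => /= ->.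
have tE : shifted_pos k = s + q by rewrite /q addrC subrK.
split; rewrite ?ltr0z ?ltrz0 ?pmulr_rgt0 ?pmulr_rlt0 // => h.
- have [rs' [h1 h2 h3]] := column_raise s cI hc h.
  by exists rs'; rewrite h2 h3 tE.
- have [rs' [h1 h2 h3]] := column_lower s cI hc h.
  by exists rs'; rewrite h2 h3 tE.
Qed.

End Closure.

Definition is_bar (a : label) : bool := if a is Bar _ then true else false.

(** * Spin columns are stable under the operators *)
Section Spin.
Variables (X : cartan_type) (n : nat) (w : nat -> nat).
Hypotheses (hn : valid_rank X n) (hw : index_sequence n w) (XA : X <> TypeA).

Local Notation y := (shifted_x X n w).
Local Notation B := (shifted_beta X n w).
Local Notation bx := (box X n w).
Local Notation shifted_pos := (shifted_pos X n w).
Local Notation mult := (mult X n).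
Local Notation lag := (lag X n).
Local Notation src1 := (src1 X n).
Local Notation dst1 := (dst1 X n).
Local Notation src2 := (src2 X n).
Local Notation dst2 := (dst2 X n).
Local Notation column := (column X n).
Local Notation column_sum := (column_sum X n w).

Definition spin_mult : int := if X is TypeB then 2 else 1.

(** In types C and D the first summand is the box of the leading letter, the bar of
n+1.  The factor 2 in type B accounts for the unbarred letters of the column,
which contribute the same as the barred ones up to y_n. *)
Definition spin_sum (rs : seq label) (s : int) : Qinf_dual :=
  y n (s + (size rs)%:Z) + spin_mult%:~R *: column_sum rs s.

Definition bar_column (rs : seq label) : Prop := column rs /\ all is_bar rs.

Lemma n_in_I : in_I n n.
Proof. by rewrite /in_I; case: X hn => /=; lia. Qed.

Lemma entry_bar rs q j : all is_bar rs -> (0 < j)%N -> entry rs q != Plain j.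
Proof.
move=> hb j0; case: q => [m|m] //=; have [lt|ge] := ltnP m (size rs).
  by have := all_nthP (Plain 0) hb m lt; case: nth.
by rewrite nth_default // labelE; lia.
Qed.

Lemma column_rcons rs a : column (rcons rs a) <->
  [/\ column rs, in_J X n a & nd X n a (entry rs ((size rs)%:Z - 1))].
Proof.
have eN q : q < (size rs)%:Z -> entry (rcons rs a) q = entry rs q.
  by move=> h; rewrite -cats1 entry_cat h.
have eS : entry (rcons rs a) (size rs)%:Z = a.
  by rewrite -cats1 entry_cat ltxx subrr.
split.
  case; rewrite size_rcons => h1 h2.
  have aJ : in_J X n a by rewrite -eS; apply: h1; lia.
  have hJ q : 0 <= q < (size rs)%:Z -> in_J X n (entry rs q).
    by move=> hq; rewrite -eN; [apply: h1|]; lia.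
  split => //; last first.
    by have := h2 ((size rs)%:Z - 1); rewrite subrK eS eN; [apply|]; lia.
  split => // q hq; have [e|ne] := eqVneq (q + 1) (size rs)%:Z.
    rewrite e entry_big //; have [q0|q0] := ltP q 0; first by rewrite entry_neg ?nd_top_bot.
    by apply: nd_top; apply: hJ; lia.
  by rewrite -!eN; [apply: h2| |]; lia.
case=> -[h1 h2] aJ ha; split=> q; rewrite size_rcons => hq.
  by have [->|ne] := eqVneq q (size rs)%:Z; rewrite ?eS // eN; [apply: h1|]; lia.
have [->|ne] := eqVneq q (size rs)%:Z.
  by rewrite eS entry_big ?size_rcons ?nd_top //; lia.
have [e|ne2] := eqVneq (q + 1) (size rs)%:Z.
  rewrite e eS eN; last by lia.
  by have -> : q = (size rs)%:Z - 1 by lia.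
by rewrite !eN; [apply: h2| |]; lia.
Qed.

Lemma bar_column_rcons rs j : bar_column (rcons rs (Bar j)) <->
  [/\ bar_column rs, (1 <= j <= n)%N & nd X n (Bar j) (entry rs ((size rs)%:Z - 1))].
Proof.
rewrite /bar_column all_rcons /= column_rcons.
have -> : in_J X n (Bar j) = (1 <= j <= n)%N by case: X XA.
by split=> [[[h1 h2 h3] h4]|[[h1 h4] h2 h3]].
Qed.

(** The indices of the barred letters decrease from top to bottom, so above the
bar of [j] there is nothing or the bar of a larger index. *)
Lemma bar_column_top rs q j : bar_column rs -> entry rs q = Bar j -> 0 <= q ->
  (q == (size rs)%:Z - 1) || (if entry rs (q + 1) is Bar i then (j < i <= n)%N else false).
Proof.
move=> [[h1 h2] hb] e q0; have hq : q < (size rs)%:Z.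
  by rewrite ltNge; apply/negP => h; move: e; rewrite entry_big.
have [//|ne /=] := eqVneq.
have := h1 (q + 1) ltac:(lia); have := h2 q ltac:(lia); rewrite e.
case E : (entry rs (q + 1)) => [i|i].
  have := @entry_bar rs (q + 1) i hb; rewrite E eqxx.
  by case: i {E} => [|i] => [_ _|/(_ isT) //]; case: X XA.
by rewrite /nd /leJ; case: X => //=; lia.
Qed.

Lemma step2_bars c : in_I n c -> (c < n)%N ->
  src2 c = Bar c.+1 /\ dst2 c = Bar c.
Proof.
rewrite /in_I /src2 /dst2 /column_bound; case: X XA hn => // _ hn' cI cn; rewrite ?cn //.
case: ltnP => // h; rewrite ifF; last by lia.
by split; congr Bar; rewrite /= in hn'; lia.
Qed.

Lemma step1_plains c : in_I n c -> (c < n)%N ->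
  exists i j, [/\ src1 c = Plain i.+1 & dst1 c = Plain j.+1].
Proof.
rewrite /in_I /src1 /dst1 /column_bound; case: X XA hn => // _ hn' cI cn; rewrite ?cn //.
1,2: by exists c.-1, c; split => //; congr Plain; lia.
rewrite /= in hn'; case: ltnP => // h; first by exists c.-1, c; split => //; congr Plain; lia.
by rewrite ifF; [exists n.-2, n.-1; split; congr Plain|]; lia.
Qed.

Lemma excess_bar rs c q : all is_bar rs -> in_I n c -> (c < n)%N ->
  excess X n rs c q = (entry rs (q - lag c) == Bar c.+1)%:Z - (entry rs (q - lag c - 1) == Bar c)%:Z.
Proof.
move=> hb cI cn; rewrite /excess; have [-> ->] := step2_bars cI cn.
have [i [j [-> ->]]] := step1_plains cI cn.
have /negbTE -> := entry_bar q hb (ltn0Sn i); have /negbTE -> := entry_bar (q - 1) hb (ltn0Sn j).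
by rewrite subrr add0r.
Qed.

Lemma coef_spin rs s k : bar_column rs -> (1 <= k)%N ->
  coef (spin_sum rs s) k = (((w k == n) && (shifted_pos k == s + (size rs)%:Z))%:Z
     + spin_mult * (mult (w k) * excess X n rs (w k) (shifted_pos k - s)))%:~R.
Proof.
move=> [hc _] k1; rewrite /spin_sum coefD coefZ coef_shifted_x // (coef_column_sum hn hw) //; last exact: column_in.
by rewrite -intrM pmulrn -intrD (eq_sym (shifted_pos k)).
Qed.

(** Putting the bar of n on top of a spin column of length r replaces
y_n at time s+r by y_n at time s+r+1 plus [spin_mult] times one box; this
subtracts B_n. *)
Lemma spin_boxBC S : X <> TypeD ->
  y n S - y n (S + 1) - spin_mult%:~R *: bx (Bar n) S = B n S.
Proof.
have nI := n_in_I; move=> XD; rewrite /spin_mult /box; case: X XA XD hn nI => // _ _ hn' nI.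
- rewrite boxB_barE shifted_betaB // eqxx (shifted_x_out _ hw (c := n.+1)); last by rewrite /in_I; lia.
  norm_times; vec_ring.
- rewrite boxC_barE // shifted_betaC // eqxx (shifted_x_out _ hw (c := n.+1)); last by rewrite /in_I; lia.
  rewrite ifF; last by lia.
  norm_times; vec_ring.
Qed.

(** In type D the node n adds the two letters bar of n-1 and bar of n at once; a
single bar of n would lead to the other half-spin family. *)
Lemma spin_boxD S : X = TypeD ->
  y n S - y n (S + 2) - bx (Bar n.-1) S - bx (Bar n) (S + 1) = B n S.
Proof.
have nI := n_in_I; rewrite /box; case: X XA hn nI => // _ hn' nI _; rewrite /= in hn'.
rewrite !boxD_barE ?shifted_betaD // ?eqxx; last by lia.
have -> : (n.-1 == n) = false by lia.
norm_times; vec_ring.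
Qed.

Lemma excess_barBC rs q : all is_bar rs -> X <> TypeD ->
  excess X n rs n q = - (entry rs (q - 1) == Bar n)%:Z.
Proof.
move=> hb XD; rewrite /excess.
have [-> -> -> ->] : [/\ src1 n = Plain n, dst1 n = Bar n, src2 n = Plain n.+1 & dst2 n = Plain n.+1].
  by rewrite /src1 /dst1 /src2 /dst2 /column_bound; case: X XA XD => //=; rewrite ltnn.
have n0 : (0 < n)%N by case/andP: n_in_I.
have /negbTE -> := entry_bar q hb n0.
have /negbTE -> := entry_bar (q - lag n) hb (ltn0Sn n).
have /negbTE -> := entry_bar (q - lag n - 1) hb (ltn0Sn n).
by rewrite addr0 subr0 sub0r.
Qed.

Lemma excess_barD rs q : all is_bar rs -> X = TypeD ->
  excess X n rs n q = - (entry rs (q - 1) == Bar n)%:Z - (entry rs (q - 1) == Bar n.-1)%:Z.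
Proof.
move=> hb XD; have n4 : (4 <= n)%N by move: hn; rewrite XD.
have tn : column_bound X n = n.-1 by rewrite XD.
rewrite /excess lag0 ?tn ?leq_pred // subr0.
have [-> -> -> ->] : [/\ src1 n = Plain n.-1, dst1 n = Bar n, src2 n = Plain n & dst2 n = Bar n.-1].
  rewrite /src1 /dst1 /src2 /dst2 tn XD eqxx.
  by have -> : (n < n.-1)%N = false by lia.
have n0 : (0 < n)%N by lia.
have n1 : (0 < n.-1)%N by lia.
have /negbTE -> := entry_bar q hb n0; have /negbTE -> := entry_bar q hb n1.
by rewrite addr0 sub0r.
Qed.

Lemma all_bar_set_entry rs q j : all is_bar rs -> 0 <= q < (size rs)%:Z ->
  all is_bar (set_entry rs q (Bar j)).
Proof.
move=> hb hq; apply/(all_nthP (Plain 0)) => i; rewrite size_set_entry // => hi.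
have := entry_set_entry (Bar j) i hq; rewrite /= => ->; case: eqP => // _.
exact: (all_nthP _ hb).
Qed.

Lemma spin_raise rs s q c : bar_column rs -> in_I n c -> (c < n)%N ->
  entry rs q = Bar c.+1 -> entry rs (q - 1) != Bar c ->
  [/\ bar_column (set_entry rs q (Bar c)), size (set_entry rs q (Bar c)) = size rs &
    spin_sum (set_entry rs q (Bar c)) s = spin_sum rs s - (spin_mult * mult c)%:~R *: B c (s + q + lag c)].
Proof.
move=> [hc hb] cI cn e1 e2; have [l h] := step2_bars cI cn.
have [i [j [_ h1]]] := step1_plains cI cn.
have [| | |hq] := raise2 hn hw s cI hc (q := q); rewrite ?l ?h ?h1 //.
  by apply/implyP => _; apply: entry_bar.
move=> hc' e; split; [by split; last exact: all_bar_set_entry|exact: size_set_entry|].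
by rewrite /spin_sum size_set_entry // e intrM; vec_ring.
Qed.

Lemma spin_lower rs s q c : bar_column rs -> in_I n c -> (c < n)%N ->
  entry rs q = Bar c -> entry rs (q + 1) != Bar c.+1 ->
  [/\ bar_column (set_entry rs q (Bar c.+1)), size (set_entry rs q (Bar c.+1)) = size rs &
    spin_sum (set_entry rs q (Bar c.+1)) s = spin_sum rs s + (spin_mult * mult c)%:~R *: B c (s + q + lag c)].
Proof.
move=> [hc hb] cI cn e1 e2; have [l h] := step2_bars cI cn.
have [| |hq] := lower2 hn hw s cI hc (q := q); rewrite ?l ?h //.
move=> hc' e; split; [by split; last exact: all_bar_set_entry|exact: size_set_entry|].
by rewrite /spin_sum size_set_entry // e intrM; vec_ring.
Qed.

Lemma spin_addBC rs s : X <> TypeD ->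
  spin_sum (rcons rs (Bar n)) s = spin_sum rs s - B n (s + (size rs)%:Z).
Proof.
move=> XD; rewrite -spin_boxBC // /spin_sum size_rcons column_sum_rcons.
have -> : s + (size rs).+1%:Z = s + (size rs)%:Z + 1 by lia.
by vec_ring.
Qed.

Lemma spin_addD rs s : X = TypeD ->
  spin_sum (rcons (rcons rs (Bar n.-1)) (Bar n)) s = spin_sum rs s - B n (s + (size rs)%:Z).
Proof.
move=> XD; rewrite -spin_boxD // /spin_sum !size_rcons !column_sum_rcons size_rcons.
have -> : s + (size rs).+2%:Z = s + (size rs)%:Z + 2 by lia.
have -> : s + (size rs).+1%:Z = s + (size rs)%:Z + 1 by lia.
by rewrite /spin_mult XD; vec_ring.
Qed.

Lemma spin_mult_gt0 : 0 < spin_mult.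
Proof. by rewrite /spin_mult; case: X. Qed.

Lemma spin_mult_mult_n : X <> TypeD -> spin_mult * mult n = 2.
Proof. by rewrite /spin_mult /mult; case: X XA => //=; rewrite eqxx. Qed.

Lemma entry_last rs q j : bar_column rs -> entry rs q = Bar j -> (0 < j)%N -> q = (size rs)%:Z - 1 ->
  exists rs', rs = rcons rs' (Bar j).
Proof.
move=> hb e j0 eq; case/lastP: rs hb e eq => [|rs a] hb e eq.
  by move: e j0; rewrite eq /= => -[<-].
exists rs; move: e; rewrite eq size_rcons.
have -> : (size rs).+1%:Z - 1 = (size rs)%:Z by lia.
by rewrite -!cats1 entry_cat ltxx subrr /= => ->.
Qed.

(** In type D the parity of the length separates the two half-spin families. *)
Definition spin_set (par : bool) (s : int) (phi : Qinf_dual) : Prop :=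
  exists rs, [/\ bar_column rs, X = TypeD -> odd (size rs) = par & phi = spin_sum rs s].

Lemma last_bar rs : bar_column rs -> exists2 i, entry rs ((size rs)%:Z - 1) = Bar i & (i <= n)%N.
Proof.
move=> [[h1 _]]; case/lastP: rs h1 => [|rs a]; first by exists 0%N.
have E : entry (rcons rs a) ((size (rcons rs a))%:Z - 1) = a.
  rewrite size_rcons (_ : _ - 1 = (size rs)%:Z); last by lia.
  by rewrite -cats1 entry_cat ltxx subrr.
move=> h1; have := h1 ((size (rcons rs a))%:Z - 1) ltac:(rewrite size_rcons; lia).
rewrite E all_rcons => aJ /andP[ha _]; case: a ha aJ {E h1} => // j _ aJ.
by exists j => //; move: aJ; case: X XA => //= _ /andP[].
Qed.

Lemma bar_column_top_n rs q : bar_column rs -> entry rs q = Bar n -> q = (size rs)%:Z - 1.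
Proof.
move=> hb e; have n0 : (0 < n)%N by case/andP: n_in_I.
have q0 : 0 <= q by rewrite leNgt; apply/negP => /(entry_neg rs); rewrite e => -[]; lia.
case/orP: (bar_column_top hb e q0) => [/eqP //|]; case: (entry _ _) => // i; lia.
Qed.

(** At a node [c < n] this is the stability of columns.  At node n the leading
variable takes part: the coefficient is 1 when node n can add letters on top, and -1 when
it can remove them. *)
Lemma stable_spin par s : stable X n w (spin_set par s).
Proof.
move=> phi k [rs [hb hp ->]] k1; rewrite (coef_spin s hb k1).
have := w_in hw k1; move: (shifted_pos k) => t; move: (w k) => c cI.
have : exists q, t = s + q by exists (t - s); lia.
case=> q ->; rewrite (_ : s + q - s = q); last by lia.
rewrite (_ : (s + q == s + (size rs)%:Z) = (q == (size rs)%:Z)); last by lia.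
have [lt|ge] := ltnP c n.
  have -> : (c == n) = false by lia.
  have N0 : 0 < spin_mult * mult c by rewrite mulr_gt0 ?spin_mult_gt0 ?mult_gt0.
  rewrite add0r mulrA excess_bar; [|by case: hb|done|done].
  have [e1|e1] := eqVneq (entry rs (q - lag c)) (Bar c.+1);
  have [e2|e2] := eqVneq (entry rs (q - lag c - 1)) (Bar c).
  - by rewrite subrr mulr0; split; rewrite ltxx.
  - rewrite subr0 mulr1; split; last by rewrite ltrz0; lia.
    move=> _; have [h1 h2 h3] := spin_raise s hb cI lt e1 e2.
    exists (set_entry rs (q - lag c) (Bar c)); split => //; first by rewrite h2.
    by rewrite h3; congr (_ - _ *: B c _); lia.
  - rewrite sub0r mulrN1; split; first by rewrite ltr0z; lia.
    move=> _; have [|h1 h2 h3] := spin_lower s hb cI lt e2.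
      by rewrite subrK.
    exists (set_entry rs (q - lag c - 1) (Bar c.+1)); split => //; first by rewrite h2.
    rewrite h3 mulrNz scaleNr opprK; congr (_ + _ *: B c _); lia.
  - by rewrite subrr mulr0; split; rewrite ltxx.
have ec : c = n by move/andP: cI => [_ cI]; apply/eqP; rewrite eqn_leq cI.
rewrite ec eqxx andTb mulrA.
have n0 : (0 < n)%N by case/andP: n_in_I.
have n4 : X = TypeD -> (4 <= n)%N by move=> XD; move: hn; rewrite XD.
have [XD|XD] : X = TypeD \/ X <> TypeD by case: X; [right|right|right|left].
  rewrite excess_barD //; last by case: hb.
  have -> : spin_mult * mult n = 1 by rewrite /spin_mult /mult XD.
  rewrite mul1r; have {}n4 := n4 XD.
  have [eq|nq] := eqVneq q (size rs)%:Z.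
    have [e1|e1] := eqVneq (entry rs (q - 1)) (Bar n).
      by rewrite e1 labelE; have -> : (n == n.-1) = false by lia; split; rewrite ltxx.
    have [e2|e2] := eqVneq (entry rs (q - 1)) (Bar n.-1); first by split; rewrite ltxx.
    split; last by rewrite ltrz0.
    move=> _; exists (rcons (rcons rs (Bar n.-1)) (Bar n)); split.
    - have [i ei ile] := last_bar hb.
      move: e1 e2; rewrite eq ei !labelE => e1 e2.
      apply/bar_column_rcons; split; [|by rewrite leqnn n0|].
        apply/bar_column_rcons; split => //; first by move: n4; lia.
        by rewrite ei nd_bars; lia.
      by rewrite size_rcons (_ : _ - 1 = (size rs)%:Z); [rewrite -cats1 entry_cat ltxx subrr nd_bars|]; lia.
    - by move=> _; rewrite !size_rcons /= negbK hp.
    - by rewrite spin_addD // eq addr0 scale1r.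
  have [e1|e1] := eqVneq (entry rs (q - 1)) (Bar n).
    by have := bar_column_top_n hb e1; lia.
  have [e2|e2] := eqVneq (entry rs (q - 1)) (Bar n.-1); last by split; rewrite ltxx.
  split; first by rewrite ltr0z.
  have q0 : 0 <= q - 1 by rewrite leNgt; apply/negP => /(entry_neg rs); rewrite e2 => -[]; lia.
  move=> _; case/orP: (bar_column_top hb e2 q0) => [/eqP|]; first by lia.
  rewrite subrK; case e3 : (entry rs q) => [|i] //= hi.
  have ei : i = n by lia.
  rewrite {}ei {hi} in e3; have qe := bar_column_top_n hb e3.
  have [rs1 r1] := entry_last hb e3 n0 qe.
  move: hb hp qe e2; rewrite {}r1 size_rcons => /bar_column_rcons [hb1 _ _] hp qe.
  rewrite -cats1 entry_cat ifT; last by lia.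
  move=> e2; have n1 : (0 < n.-1)%N by lia.
  have [|rs2 r2] := entry_last hb1 e2 n1; first by lia.
  move: hb1 hp qe; rewrite {}r2 size_rcons => /bar_column_rcons [hb2 _ _] hp qe.
  exists rs2; split => //; first by move/hp; rewrite /= negbK.
  rewrite cats1 spin_addD // sub0r scaleN1r opprK.
  rewrite (_ : s + q - 1 = s + (size rs2)%:Z); last by lia.
  by vec_ring.
rewrite spin_mult_mult_n // excess_barBC //; last by case: hb.
have [eq|nq] := eqVneq q (size rs)%:Z; have [e1|e1] := eqVneq (entry rs (q - 1)) (Bar n).
- split; first by rewrite ltr0z.
  move=> _; have [|rs' e] := entry_last hb e1 n0; first by rewrite eq.
  move: hb hp eq; rewrite e size_rcons => /bar_column_rcons [hb' _ _] _ eq.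
  exists rs'; split => //; rewrite spin_addBC // /= scaleN1r opprK eq.
  rewrite (_ : s + (size rs').+1%:Z - 1 = s + (size rs')%:Z); last by lia.
  by vec_ring.
- rewrite mulr0 addr0; split; last by rewrite ltrz0.
  move=> _; exists (rcons rs (Bar n)); split.
  + apply/bar_column_rcons; split; rewrite ?leqnn ?n0 //.
    have [i ei ile] := last_bar hb; move: e1; rewrite eq ei labelE nd_bars; lia.
  + by move=> XD'; case: (XD XD').
  + by rewrite spin_addBC // eq scale1r.
- by have := bar_column_top_n hb e1; lia.
- by rewrite mulr0 addr0; split; rewrite ltxx.
Qed.

End Spin.

(** * Reaching every column *)

(** Increases along every step; moreover the sum over j and its bar increases
with j, so that replacing j+1 and its bar by j and its bar decreases it. *)
Definition label_weight (n : nat) (a : label) : int :=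
  match a with Plain j => 2 * j%:Z | Bar j => 3 * n%:Z + 1 - j%:Z end.
Definition column_weight (n : nat) (rs : seq label) : int := \sum_(a <- rs) label_weight n a.

Lemma column_weight_set_entry n rs q x : 0 <= q < (size rs)%:Z ->
  column_weight n (set_entry rs q x) = column_weight n rs - label_weight n (entry rs q) + label_weight n x.
Proof.
case: q => // m; rewrite /set_entry /= => hm; have {}hm : (m < size rs)%N by lia.
rewrite /column_weight; elim: rs m hm => [|a r IH] [|m] //= hm; rewrite !big_cons; first by ring.
by rewrite IH //; ring.
Qed.

Section Reach.
Variables (X : cartan_type) (n : nat) (w : nat -> nat).
Hypotheses (hn : valid_rank X n) (hw : index_sequence n w) (had : adapted X n w).

Local Notation y := (shifted_x X n w).
Local Notation B := (shifted_beta X n w).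
Local Notation bx := (box X n w).
Local Notation shifted_pos := (shifted_pos X n w).
Local Notation mult := (mult X n).
Local Notation lag := (lag X n).
Local Notation src1 := (src1 X n).
Local Notation dst1 := (dst1 X n).
Local Notation src2 := (src2 X n).
Local Notation dst2 := (dst2 X n).
Local Notation column := (column X n).
Local Notation column_sum := (column_sum X n w).
Local Notation P := (P_ X n w).
Local Notation column_bound := (column_bound X n).
Local Notation Xi := (Xi X n w).
Local Notation label_weight := (label_weight n).
Local Notation column_weight := (column_weight n).

Lemma P_step j : (1 <= j)%N -> (j < column_bound)%N -> (j < n)%N -> (P j <= P j.+1 <= (P j).+1)%N.
Proof.
move=> j1 jt jn; rewrite P_succ //.
  by have p1 : (p_ w j.+1 j <= 1)%N := leq_b1 _; lia.
by move: jt hn; case: X => /=; [left|left|left|right; lia].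
Qed.

Lemma P_mono i j : (1 <= i)%N -> (i <= j)%N -> (j <= column_bound)%N -> (j <= n)%N ->
  (P i <= P j <= P i + (j - i))%N.
Proof.
move=> i1; elim: j => [|j IH] ij jt jn; first by lia.
have [e|ne] := eqVneq i j.+1; first by rewrite e; lia.
have := IH ltac:(lia) ltac:(lia) ltac:(lia); have := @P_step j ltac:(lia) ltac:(lia) jn; lia.
Qed.

Lemma P_last c : (column_bound <= c <= n)%N ->
  (P c = P column_bound \/ P column_bound.-1 <= P c <= (P column_bound.-1).+1)%N.
Proof.
move=> cI; have [->|ne] := eqVneq c column_bound; first by left.
right; have XD : X = TypeD by move: cI ne; case: X => //=; lia.
have cn : c = n by move: cI ne; rewrite XD /=; lia.
rewrite cn (P_Dn _ hn XD) XD /= (_ : n.-2 = n - 2)%N; last by lia.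
by have p1 : (p_ w n (n - 2) <= 1)%N := leq_b1 _; lia.
Qed.

(** P varies by at most one along an edge; this compares a node below
[column_bound] with the nodes from it on. *)
Lemma P_special j c : (1 <= j < column_bound)%N -> (column_bound <= c <= n)%N ->
  (P j <= P c <= P j + (column_bound - j))%N.
Proof.
move=> jt ct; have := @P_mono j column_bound; have := @P_mono j column_bound.-1.
have [->|] := P_last ct; lia.
Qed.

(** The second step of [j] is applied at least [column_bound - j] units of time
after s, so that this bound makes its position exist whenever s + P(k) >= 1. *)
Lemma P_bar j k : X <> TypeA -> (1 <= j < column_bound)%N -> (1 <= k < column_bound)%N ->
  (P k <= P j + (column_bound - j))%N.
Proof.
move=> XA jt kt; have tn : (column_bound <= column_bound <= n)%N by case: X XA hn => //=; lia.
have := P_special jt tn; have := P_special kt tn; lia.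
Qed.

Lemma Xi_x k : (1 <= k)%N -> Xi (x_ k).
Proof. by move=> k1; exists k, [::]. Qed.

Lemma Xi_S phi k : (1 <= k)%N -> Xi phi -> Xi (S_op X n w k phi).
Proof.
move=> k1 [j0 [js [j1 hjs ->]]]; exists j0, (rcons js k); split => //.
  by rewrite all_rcons k1.
by rewrite -cats1 foldl_cat.
Qed.

Lemma Xi_ind (M : Qinf_dual -> Prop) phi :
  (forall k, (1 <= k)%N -> M (x_ k)) ->
  (forall psi k, (1 <= k)%N -> M psi -> M (S_op X n w k psi)) -> Xi phi -> M phi.
Proof.
move=> h0 hS [j0 [js [j1 hjs ->]]]; elim/last_ind: js hjs => [|js k IH] /=; first by move=> _; apply: h0.
by rewrite all_rcons => /andP[k1 hjs]; rewrite -cats1 foldl_cat /=; apply: hS => //; apply: IH.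
Qed.

Lemma Xi_shifted_x c t : in_I n c -> 1 <= t + (P c)%:Z -> Xi (y c t).
Proof.
move=> cI t1; have [k [k1 <- <-]] := shifted_pos_surj hw cI t1.
by rewrite shifted_x_pos //; apply: Xi_x.
Qed.

Lemma Xi_raise (r : int) c t phi psi : in_I n c -> 1 <= t + (P c)%:Z -> Xi phi -> 0 < r ->
  (forall k, (1 <= k)%N -> w k = c -> shifted_pos k = t -> coef phi k = r%:~R) ->
  psi = phi - r%:~R *: B c t -> Xi psi.
Proof.
move=> cI t1 hphi r0 hc ->; have [k [k1 wk tk]] := shifted_pos_surj hw cI t1.
have := Xi_S k1 hphi; rewrite /S_op (hc k) // ltr0z r0.
by rewrite (betaE hw hn had) // wk tk.
Qed.

(** With excess 1 the operator subtracts exactly one step; the condition on P says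
that its position exists. *)
Lemma Xi_column_raise rs rs' s q c : in_I n c -> column rs -> 1 <= s + q + (P c)%:Z ->
  excess X n rs c q = 1 -> Xi (column_sum rs s) ->
  column_sum rs s = column_sum rs' s + (mult c)%:~R *: B c (s + q) -> Xi (column_sum rs' s).
Proof.
move=> cI hc hp he hX e; apply: (Xi_raise (r := mult c) (c := c) (t := s + q) _ _ hX) => //.
- exact: mult_gt0.
- move=> k k1 wk tk; rewrite (coef_column_sum hn hw) ?column_in // wk tk.
  rewrite (_ : s + q - s = q); last by lia.
  by rewrite -/(excess X n rs c q) he mulr1.
- by rewrite e; vec_ring.
Qed.

Lemma column_weight_ge0 rs : column rs -> 0 <= column_weight rs.
Proof.
move/column_in/allP => h; rewrite /column_weight big_seq; apply: sumr_ge0 => a /h {h}.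
by rewrite /label_weight; case: a => j; case: X => //=; lia.
Qed.

Lemma label_weight_step1 c : in_I n c -> label_weight (src1 c) < label_weight (dst1 c).
Proof.
rewrite /in_I /label_weight /src1 /dst1 /column_bound; case: X hn => /= hn' cI; repeat case: ifP => ?; rewrite /=; lia.
Qed.

Lemma label_weight_step2 c : in_I n c -> in_J X n (src2 c) -> label_weight (src2 c) < label_weight (dst2 c).
Proof.
rewrite /in_I /label_weight /src2 /dst2 /column_bound; case: X hn => /= hn' cI; repeat case: ifP => ?; rewrite /=; lia.
Qed.

Lemma steps_below_bound c : (c < column_bound)%N -> [/\ src1 c = Plain c, dst1 c = Plain c.+1, src2 c = Bar c.+1
   & dst2 c = Bar c].
Proof. by rewrite /src1 /dst1 /src2 /dst2 => ->. Qed.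

(** The relation [nd] is not transitive in type D, but from a letter comparable to
all others the order propagates down the column. *)
Lemma plain_below rs (q : int) m (q' : int) : column rs -> entry rs q = Plain m -> 0 <= q < (size rs)%:Z ->
  (m <= column_bound)%N -> q' < q -> if entry rs q' is Plain i then (m < i)%N else true.
Proof.
move=> [h1 h2] e hq mt; have [h0|h0] := ltP q' 0; first by rewrite entry_neg.
move=> lt; pose good b := if b is Plain i then (m < i)%N else true.
have step a b : good a || (a == Plain m) -> nd X n a b -> good b.
  move: mt hn; rewrite /good /nd /leJ; case: a => i; case: b => j; rewrite ?labelE;
    case: X => /=; lia.
have H d : 0 <= q - d%:Z -> good (entry rs (q - d%:Z)) || (entry rs (q - d%:Z) == Plain m).
  elim: d => [|d IH] hd; first by rewrite subr0 e eqxx orbT.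
  have /step h := IH ltac:(lia); rewrite h //.
  have := h2 (q - d.+1%:Z) ltac:(lia).
  by have -> : q - d.+1%:Z + 1 = q - d%:Z by lia.
have /step h := H (absz (q - q' - 1)%R) ltac:(lia); apply: h.
have := h2 q' ltac:(lia); have -> // : q' + 1 = q - (absz (q - q' - 1)%R)%:Z by lia.
Qed.

(** Directly below [dst2 c] neither target of the node [c] can stand, so after
lowering it the excess is 1. *)
Lemma lower_special rs s q c : in_I n c -> (column_bound <= c)%N -> column rs ->
  1 <= s + q + (P c)%:Z ->
  entry rs q = dst2 c -> entry rs (q + 1) != src2 c ->
  let rs' := set_entry rs q (src2 c) in
  [/\ column rs', size rs' = size rs, column_weight rs' < column_weight rs & Xi (column_sum rs' s) -> Xi (column_sum rs s)].
Proof.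
move=> cI ct hc hp e1 e2 rs'.
have [hq h1 h2] := lower2 hn hw s cI hc e1 e2.
have [h3 h4] := hc; have lJ : in_J X n (src2 c) by rewrite step2_in // -e1; apply: h3.
split => //; first exact: size_set_entry.
  by rewrite column_weight_set_entry // e1; have := label_weight_step2 cI lJ; lia.
have b1 := h4 (q - 1) ltac:(lia); rewrite subrK e1 in b1.
move=> hX; apply: (Xi_column_raise (rs := rs') (q := q) cI) => //; last first.
  by rewrite h2 lag0 // addr0.
rewrite /excess lag0 // subr0 !entry_set_entry // eqxx ifF; last by lia.
have -> : (src2 c == src1 c) = false by rewrite eq_sym; apply: negbTE; exact: src1_neq_src2.
have -> : (entry rs (q - 1) == dst1 c) = false.
  apply/eqP => e3; move: b1 lJ; rewrite e3 /nd /leJ /dst1 /dst2 /src2.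
  by move: ct cI hn; rewrite /in_I; case: X => /= ct cI hn'; repeat case: ifP => ?; rewrite /= ?labelE; lia.
have -> : (entry rs (q - 1) == dst2 c) = false.
  by apply/eqP => e3; move: b1; rewrite e3 /nd /leJ; case: (dst2 c) => j /=; rewrite eqxx.
by rewrite eqxx.
Qed.

Definition initial_run (rs : seq label) (p : nat) : Prop :=
  forall v : nat, (1 <= v <= p)%N -> entry rs ((size rs)%:Z - v%:Z) = Plain v.

Lemma initial_run_ex rs m : initial_run rs m \/
  exists p : nat, [/\ (p < m)%N, initial_run rs p & entry rs ((size rs)%:Z - p.+1%:Z) <> Plain p.+1].
Proof.
elim: m => [|m [IH|[p [h1 h2 h3]]]]; first by left => v; lia.
  have [e|/eqP ne] := eqVneq (entry rs ((size rs)%:Z - m.+1%:Z)) (Plain m.+1).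
    left => v hv; have [->//|ne] := eqVneq v m.+1; apply: IH; lia.
  by right; exists m.
by right; exists p; split => //; lia.
Qed.

Lemma box_plain j s : (j < column_bound)%N -> bx (Plain j) s = y j s - y j.-1 (s + 1).
Proof.
rewrite /box; case: X hn => hn' hj; rewrite /= in hn' hj.
- by rewrite boxAE.
- by rewrite boxBE.
- by rewrite boxCE ifF //; lia.
- by rewrite boxDE ifF //; lia.
Qed.

Lemma column_sum_initial_run rs s : (size rs < column_bound)%N ->
  initial_run rs (size rs) -> column_sum rs s = y (size rs) s.
Proof.
elim: rs s => [|a rs IH] s hs hp; first by rewrite (shifted_x_out _ hw (c := 0%N)).
have ea : a = Plain (size rs).+1.
  by have := hp (size rs).+1; rewrite /= subrr /= => -> //; lia.
rewrite [column_sum _ _]/= IH.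
- by rewrite ea box_plain // /=; vec_ring.
- exact: ltnW hs.
move=> v hv; have := hp v; rewrite entry_cons [size _]/= ifF; last by lia.
move=> <-; last by lia.
by congr (entry rs _); lia.
Qed.

(** In this section the rows of [rs] above depth [d] contain 1, ..., p.  The entry
at depth [d] differs from p+1, so it can be lowered. *)
Section Step.
Variables (rs : seq label) (p : nat) (s : int).
Let d : int := (size rs)%:Z - p.+1%:Z.
Hypotheses (hc : column rs) (hpre : initial_run rs p) (pk : (p < size rs)%N) (kt : (size rs < column_bound)%N).
Hypothesis (hs : 1 <= s + (P (size rs))%:Z).
Hypothesis (IH : forall rs', column rs' -> size rs' = size rs -> column_weight rs' < column_weight rs ->
  Xi (column_sum rs' s)).

Lemma d_range : 0 <= d < (size rs)%:Z.
Proof. rewrite /d; lia. Qed.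

Lemma entry_above (q : int) : d < q -> entry rs q = Plain (size rs - absz q)%N.
Proof.
move=> dq; have := d_range; have [lt|ge] := ltP q (size rs)%:Z => hd.
  have := hpre (v := (size rs - absz q)%N); rewrite /d in dq hd *; move=> <-; last by lia.
  by congr (entry rs _); lia.
by rewrite entry_big //; congr Plain; lia.
Qed.

Lemma entry_above_run : entry rs (d + 1) = Plain p.
Proof. by rewrite entry_above; [congr Plain; rewrite /d|]; lia. Qed.

Lemma step_special c : in_I n c -> (column_bound <= c)%N -> entry rs d = dst1 c -> Xi (column_sum rs s).
Proof.
move=> cI ct ed; have hd := d_range.
have hPc : (P (size rs) <= P c)%N.
  by have := @P_special (size rs) c; move: cI; rewrite /in_I; lia.
have [_ h2] := hc.
have XA : X <> TypeA by move=> XA; move: ct cI; rewrite XA /in_I /=; lia.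
have hl2 : dst1 c != src2 c.
  move: ct cI hn; rewrite /in_I /dst1 /src2; case: X XA => //= _ ct cI hn';
    repeat case: ifP => ?; rewrite ?labelE; lia.
have [e|ne] := eqVneq (entry rs (d - 1)) (dst2 c).
  have hd1 : 0 <= d - 1.
    rewrite leNgt; apply/negP => h0; have [_ _ _] := step_proper hn cI.
    by rewrite -e entry_neg // !inE eqxx orbT.
  have [| |h1 h3 h4] := @lower_special rs s (d - 1) c cI ct hc _ e.
  - by rewrite /d in hd1 *; lia.
  - by rewrite subrK ed.
  by apply; apply: IH.
have [| |_ h3 h4] := lower1 hn hw s cI hc ed.
- rewrite entry_above_run; move: ct cI kt hn; rewrite /in_I /src1; case: X XA => //= _ ct cI kt' hn';
    repeat case: ifP => ?; rewrite ?labelE; lia.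
- apply/implyP => _; rewrite entry_above_run; move: ct cI kt hn.
  rewrite /in_I /src2; case: X XA => //= _ ct cI kt' hn';
    repeat case: ifP => ?; rewrite ?labelE; lia.
apply: (Xi_column_raise (rs := set_entry rs d (src1 c)) (q := d) (c := c)) => //.
- lia.
- rewrite /excess lag0 // subr0 !entry_set_entry // eqxx ifF; last by lia.
  rewrite (negbTE ne) (negbTE (src1_neq_src2 hn cI)) eqxx.
  have := h2 (d - 1) ltac:(lia); rewrite subrK ed => hnd.
  have -> : (entry rs (d - 1) == dst1 c) = false.
    by apply/eqP => e3; move: hnd; rewrite e3 /nd /leJ; case: (dst1 c) => j /=; rewrite eqxx.
  by [].
apply: IH => //; first exact: size_set_entry.
by rewrite column_weight_set_entry // ed; have := label_weight_step1 cI; lia.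
Qed.

(** The other step of node [u] would need u or u+1 in a row where the initial run
has another letter; this is where the length being less than [column_bound]
matters. *)
Lemma step_bar u : (u < column_bound)%N -> entry rs d = Bar u -> Xi (column_sum rs s).
Proof.
move=> ut ed; have hd := d_range; have [h1 h2] := hc.
have := h1 d hd; rewrite ed => uJ.
have XA : X <> TypeA by move=> XA; move: uJ; rewrite XA.
have u1 : (1 <= u <= n)%N by move: uJ; case: X XA.
have uI : in_I n u by [].
have [l1 g1 l2 g2] := steps_below_bound ut.
have e1 : entry rs d = dst2 u by rewrite g2.
have [|hq h3 h4] := lower2 hn hw s uI hc e1.
  by rewrite entry_above_run l2.
have o1 := lag_gt0 hn ut; have oE : lag u = (column_bound - u)%N%:Z by [].
apply: (Xi_column_raise (rs := set_entry rs d (src2 u)) (q := d + lag u) (c := u)) => //.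
- have := @P_bar u (size rs) XA; rewrite oE; lia.
- rewrite /excess l1 g1 g2 l2 addrK !entry_set_entry // eqxx.
  have := h2 (d - 1) ltac:(lia); rewrite subrK ed => hnd.
  have -> : ((if d - 1 == d then Bar u.+1 else entry rs (d - 1)) == Bar u) = false.
    rewrite ifF; last by lia.
    by apply/eqP => e; move: hnd; rewrite e /nd /leJ /= eqxx.
  rewrite (entry_above (_ : d < d + lag u)); last by lia.
  rewrite ifF; last by lia.
  rewrite labelE (_ : (size rs - absz (d + lag u)%R == u)%N = false); last first.
    by rewrite oE /d; lia.
  rewrite eqxx; case: ifP => [_|ne] //.
  rewrite (entry_above (_ : d < d + lag u - 1)); last by lia.
  rewrite labelE (_ : (size rs - absz (d + lag u - 1)%R == u.+1)%N = false) //.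
  by rewrite oE /d; lia.
- apply: IH => //; first exact: size_set_entry.
  by rewrite column_weight_set_entry // ed l2 /label_weight; lia.
- by rewrite h4 (addrA s d).
Qed.

(** Lowering j+1 to j works unless the other step of node j contributes.  The four
cases say whether its source, the bar of j+1, and its target, the bar of j, stand
at the matching depths. *)
Lemma step_plain j : (p < j < column_bound)%N -> entry rs d = Plain j.+1 -> Xi (column_sum rs s).
Proof.
move=> jt ed; have hd := d_range; have [h1 h2] := hc.
have jt' : (j < column_bound)%N by lia.
have jn : (j <= n)%N by have := h1 d hd; rewrite ed; move: jt'; case: X => //=; lia.
have jI : in_I n j by rewrite /in_I; lia.
have [l1 g1 l2 g2] := steps_below_bound jt'.
have o1 := lag_gt0 hn jt'; have oE : lag j = (column_bound - j)%N%:Z by [].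
have below q : q < d -> entry rs q != Plain j /\ entry rs q != Plain j.+1.
  move=> qd; have := plain_below hc ed hd ltac:(lia) qd.
  by case: (entry rs q) => i; rewrite !labelE //; lia.
have e1 : entry rs d = dst1 j by rewrite g1.
have [| |_ h3 h4] := lower1 hn hw s jI hc e1.
- by rewrite entry_above_run l1 labelE; lia.
- by apply/implyP; lia.
have tn : (column_bound <= n.+1)%N by case: X hn => /=; lia.
have hP : (P (size rs) <= P j + (size rs - j) /\ P (size rs) <= P j + (size rs - p.+1))%N.
  have [le|gt] := leqP (size rs) j.
    by have := @P_mono (size rs) j; lia.
  by have := @P_mono j (size rs); lia.
have w1 : column_weight (set_entry rs d (src1 j)) = column_weight rs - 2.
  by rewrite column_weight_set_entry // ed l1 /label_weight; lia.
have [e2|ne2] := eqVneq (entry rs (d - lag j)) (Bar j.+1);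
have [e3|ne3] := eqVneq (entry rs (d - lag j - 1)) (Bar j).
1,4: apply: (Xi_column_raise (rs := set_entry rs d (src1 j)) (q := d) (c := j)) => //;
  [rewrite /d; lia|idtac|apply: IH => //; [exact: size_set_entry|lia]];
  rewrite /excess l1 g1 l2 g2 !entry_set_entry // eqxx;
  (do 3 (rewrite ifF; last by lia)); rewrite ?e2 ?e3 ?(negbTE ne2) ?(negbTE ne3) ?eqxx;
  by have [_ /negbTE ->] := below (d - 1) ltac:(lia).
(* The two steps cancel, so the sum does not change: replace both letters. *)
- have e2' : entry (set_entry rs d (src1 j)) (d - lag j) = src2 j.
    by rewrite entry_set_entry // ifF ?e2 ?l2 //; lia.
  have [| |hq h5 h6] := raise2 hn hw s jI h3 e2'.
  + by rewrite entry_set_entry // ifF ?g2 //; lia.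
  + by apply/implyP; lia.
  rewrite size_set_entry // in hq.
  have -> : column_sum rs s = column_sum (set_entry (set_entry rs d (src1 j)) (d - lag j) (dst2 j)) s.
    rewrite h6 h4 (_ : s + (d - lag j) + lag j = s + d); last by lia.
    by vec_ring.
  apply: IH => //; first by rewrite !size_set_entry // size_set_entry.
  by rewrite column_weight_set_entry ?size_set_entry // w1 e2' l2 g2 /label_weight; lia.
(* Raising j back at depth d would be cancelled: lower the bar of j instead, which
   is undone by the operator one unit of time earlier. *)
- have e3' : entry rs (d - lag j - 1) = dst2 j by rewrite g2.
  have [|hq h5 h6] := lower2 hn hw s jI hc e3'.
    by rewrite subrK l2.
  apply: (Xi_column_raise (rs := set_entry rs (d - lag j - 1) (src2 j)) (q := d - 1) (c := j)) => //.
  + rewrite oE in hq; lia.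
  + rewrite /excess l1 g1 l2 g2 !entry_set_entry //.
    have -> : d - 1 - lag j = d - lag j - 1 by lia.
    rewrite eqxx.
    rewrite [d - 1 == _](_ : _ = false); last by lia.
    have [/negbTE -> _] := below (d - 1) ltac:(lia).
    rewrite [d - lag j - 1 - 1 == _](_ : _ = false); last by lia.
    have := h2 (d - lag j - 1 - 1) ltac:(lia); rewrite subrK e3 => hnd.
    have -> : (entry rs (d - lag j - 1 - 1) == Bar j) = false.
      by apply/eqP => e; move: hnd; rewrite e /nd /leJ /= eqxx.
    have [_ /negbTE e4] := below (d - 1 - 1) ltac:(lia).
    by rewrite eqxx; case: (_ == d - lag j - 1); rewrite ?e4.
  + apply: IH => //; first exact: size_set_entry.
    by rewrite column_weight_set_entry // e3 l2 /label_weight; lia.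
  + rewrite h6; congr (_ + _ *: B j _); lia.
Qed.
End Step.

Theorem Xi_column rs s : column rs -> (1 <= size rs < column_bound)%N -> 1 <= s + (P (size rs))%:Z ->
  Xi (column_sum rs s).
Proof.
move=> hc hk hs.
have [m hm] : exists m : nat, column_weight rs < m%:Z.
  by exists (absz (column_weight rs)).+1; lia.
elim: m rs hc hk hs hm => [|m IHm] rs hc hk hs hm.
  by have := column_weight_ge0 hc; lia.
have IH rs' : column rs' -> size rs' = size rs -> column_weight rs' < column_weight rs -> Xi (column_sum rs' s).
  by move=> h1 h2 h3; apply: IHm; rewrite ?h2 //; lia.
have kt : (size rs < column_bound)%N by lia.
(* Either the column is 1, ..., k, whose boxes telescope to y_k, or the entry
   after its longest initial run can be lowered. *)
have [hp|[p [pk hp ne]]] := initial_run_ex rs (size rs).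
  rewrite column_sum_initial_run //; apply: Xi_shifted_x => //.
  by rewrite /in_I; move: hk; case: X => /=; lia.
have [h1 h2] := hc; have aJ := h1 ((size rs)%:Z - p.+1%:Z) ltac:(lia).
have := h2 ((size rs)%:Z - p.+1%:Z) ltac:(lia).
rewrite (entry_above_run hp pk kt hs) //.
case ea : (entry rs _) ne aJ => [i|u] ne aJ hnd.
  have pi : (p.+1 < i)%N.
    have : i != p.+1 by apply/eqP => e; apply: ne; rewrite e.
    by move: hnd; rewrite /nd /leJ; case: X => /=; lia.
  have [it|it] := leqP i column_bound.
    by apply: (step_plain hc hp pk kt hs IH (j := i.-1)); [lia|rewrite prednK //; lia].
  have XD : X = TypeD by move: it aJ; case: X => //=; lia.
  have iE : i = n by move: it aJ; rewrite XD /=; lia.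
  have n4 : (4 <= n)%N by move: hn; rewrite XD.
  apply: (step_special hc hp pk kt hs IH (c := n.-1)).
  - by rewrite /in_I; lia.
  - by rewrite XD.
  - by rewrite ea iE /dst1 XD /= ltnn ifF //; lia.
have [ut|ut] := ltnP u column_bound.
  exact: (step_bar hc hp pk kt hs IH ut).
have XA : X <> TypeA by move=> XA; move: aJ; rewrite XA.
have uI : in_I n u by move: aJ; case: X XA.
have [un|un] := eqVneq u n.
  rewrite un in uI ut ea; apply: (step_special hc hp pk kt hs IH uI ut).
  by rewrite ea /dst1 ltnNge ut; case: X => //=; rewrite eqxx.
have XD : X = TypeD by move: ut uI un; rewrite /in_I; case: X XA => //= _; lia.
have n4 : (4 <= n)%N by move: hn; rewrite XD.
have uE : u = n.-1 by move: ut uI un; rewrite /in_I XD /=; lia.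
have n1I : in_I n n.-1 by rewrite /in_I; lia.
have tE : column_bound = n.-1 by rewrite XD.
have PE := @P_special (size rs) n.-1.
have [| | | |h3 h4 h5 h6] := lower_special (c := n.-1) (rs := rs) (s := s)
   (q := (size rs)%:Z - p.+1%:Z) n1I _ hc.
- by rewrite tE.
- rewrite tE in PE; lia.
- by rewrite ea uE /dst2 tE ltnn XD.
- rewrite (entry_above_run hp pk kt hs) /src2 tE ltnn XD ifF ?labelE //; lia.
by apply/h6/IH.
Qed.

End Reach.

(** * Reaching every spin column *)
Section SpinReach.
Variables (X : cartan_type) (n : nat) (w : nat -> nat).
Hypotheses (hn : valid_rank X n) (hw : index_sequence n w) (had : adapted X n w).
Hypothesis XA : X <> TypeA.

Local Notation y := (shifted_x X n w).
Local Notation B := (shifted_beta X n w).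
Local Notation shifted_pos := (shifted_pos X n w).
Local Notation mult := (mult X n).
Local Notation spin_mult := (spin_mult X).
Local Notation lag := (lag X n).
Local Notation P := (P_ X n w).
Local Notation column_bound := (column_bound X n).
Local Notation Xi := (Xi X n w).
Local Notation bar_column := (bar_column X n).
Local Notation spin_sum := (spin_sum X n w).
Local Notation column_weight := (column_weight n).

(** The node i such that the smallest tableau of the family is y_i at time s. *)
Definition spin_node (odd_size : bool) : nat :=
  if X is TypeD then (if odd_size then n.-1 else n) else n.

Lemma nd_irr a : nd X n a a = false.
Proof. by rewrite /nd /leJ; case: a => j /=; rewrite eqxx. Qed.

Lemma spin_step rs s q c : bar_column rs -> in_I n c -> (c < n)%N ->
  entry rs q = Bar c -> entry rs (q + 1) != Bar c.+1 -> 1 <= s + q + lag c + (P c)%:Z ->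
  let rs' := set_entry rs q (Bar c.+1) in
  [/\ bar_column rs', size rs' = size rs, column_weight rs' < column_weight rs & Xi (spin_sum rs' s) -> Xi (spin_sum rs s)].
Proof.
move=> hb cI cn e1 e2 hp rs'.
have [h1 h2 h3] := spin_lower hn hw XA s hb cI cn e1 e2.
have c1 : (1 <= c)%N by case/andP: cI.
have hq : 0 <= q < (size rs)%:Z.
  apply: (entry_range (x := Bar c)) => //; rewrite !inE !labelE; lia.
split => //.
  by rewrite /rs' column_weight_set_entry // e1 /label_weight; lia.
move=> hX; have N0 : 0 < spin_mult * mult c by rewrite mulr_gt0 ?spin_mult_gt0 ?mult_gt0.
apply: (Xi_raise hn hw had (r := spin_mult * mult c) (c := c) (t := s + q + lag c) _ _ hX) => //.
- by move=> k k1 wk tk; rewrite (coef_spin hn hw s h1 k1) wk tk ltn_eqF // add0r mulrA;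
  rewrite (_ : s + q + lag c - s = q + lag c); [|lia];
  rewrite excess_bar //; [|by case: h1]; rewrite addrK !entry_set_entry // eqxx (_ : (q - 1 == q) = false); [|lia];
  case: hb => -[_ h _]; have := h (q - 1) ltac:(lia); rewrite subrK e1 => hnd;
  rewrite (_ : (entry rs (q - 1) == Bar c) = false) ?eqxx ?subr0 ?mulr1 //;
  by apply/eqP => e; rewrite e nd_irr in hnd.
- by rewrite h3; vec_ring.
Qed.

Lemma spin_nil s : spin_sum [::] s = y n s.
Proof. by rewrite /spin_sum /= scaler0 !addr0. Qed.

Lemma spin_one s : X = TypeD -> spin_sum [:: Bar n] s = y n.-1 s.
Proof.
move=> XD; have n4 : (4 <= n)%N by move: hn; rewrite XD.
rewrite /spin_sum /spin_mult XD.
rewrite (_ : column_sum TypeD n w [:: Bar n] s = boxD n w (Bar n) s); last exact: addr0.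
by rewrite boxD_barE // eqxx; norm_times; vec_ring.
Qed.

(** The top letter is lowered, or removed if it is the bar of n.  In type D it is removed
together with a bar of n-1 below it; otherwise, the letter below it is lowered. *)
Theorem Xi_spin rs (s : int) : bar_column rs -> 1 <= s + (P (spin_node (odd (size rs))))%:Z -> Xi (spin_sum rs s).
Proof.
move=> hb hs; have [m hm] : exists m : nat, column_weight rs < m%:Z.
  by exists (absz (column_weight rs)).+1; lia.
elim: m rs hb hs hm => [|m IH] rs hb hs hm.
  by have := column_weight_ge0 hn (proj1 hb); lia.
have nI := n_in_I hn; have n0 : (0 < n)%N by case/andP: nI.
have tn : (column_bound <= n)%N by case: X XA => //=; lia.
have topP : (P n <= (P (spin_node (odd (size rs)))).+1 /\ P (spin_node (odd (size rs))) <= (P n).+1)%N.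
  have [XD|XD] := pselect (X = TypeD); last first.
    by rewrite (_ : spin_node _ = n) ?leqnSn // /spin_node; case: X XD.
  have tE : column_bound = n.-1 by rewrite XD.
  have n4 : (4 <= n)%N by move: hn; rewrite XD.
  have := @P_mono X n w hn n.-2 n.-1; have := @P_last X n w hn n.
  have [] : P (spin_node (odd (size rs))) = P n \/ P (spin_node (odd (size rs))) = P n.-1.
  - by rewrite /spin_node XD; case: odd; [right|left].
  - by move=> ->; lia.
  - by move=> ->; rewrite tE; lia.
case/lastP: rs hb hs hm topP => [|rs [j|u]] hb hs hm topP.
- rewrite spin_nil; apply: Xi_shifted_x => //.
  by move: hs; rewrite /spin_node /=; case: X.
- by case: hb => _; rewrite all_rcons.
have [hb' uI hnd] := proj1 (bar_column_rcons hn XA _ _) hb.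
have hsp : size (rcons rs (Bar u)) = (size rs).+1 by rewrite size_rcons.
have eq : entry (rcons rs (Bar u)) (size rs)%:Z = Bar u.
  by rewrite -cats1 entry_cat ltxx subrr.
(* Lowering a letter at a node c < n; the position exists by the bound on s,
   which is stated at one of the nodes from column_bound on. *)
have lower (q : int) c (rs0 := rcons rs (Bar u)) : in_I n c -> (c < n)%N -> 0 <= q -> entry rs0 q = Bar c ->
    entry rs0 (q + 1) != Bar c.+1 -> Xi (spin_sum rs0 s).
  move=> cI cn q0 e1 e2.
  have [|h1 h2 h3] := spin_step (s := s) hb cI cn e1 e2; last first.
    by apply; apply: IH => //; rewrite ?h2 //; lia.
  move: hs; rewrite -/rs0; set c0 := spin_node _ => hs.
  have c0I : (column_bound <= c0 <= n)%N.
    by rewrite /c0 /spin_node; move: hn; case: X XA => //= _ hn'; rewrite ?leqnn //; case: (odd _); lia.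
  have [ct|ct] := ltnP c column_bound.
    have := @P_special X n w hn c c0; have := lag_gt0 hn ct.
    have -> : lag c = (column_bound - c)%N%:Z by [].
    by case/andP: cI; lia.
  rewrite lag0 // addr0; move: ct hs; rewrite /c0 /spin_node; case EX: X XA => //= _ ct hs; try lia.
  have cE : c = n.-1 by lia.
  have n4 : (4 <= n)%N by move: hn; rewrite EX.
  have := bar_column_top hn XA hb e1 q0; case/orP => [/eqP qE|]; last first.
    rewrite -/rs0; move: e2; case: (entry _ _) => // i; rewrite labelE => h1 h2; exfalso; clear -h1 h2 cE n0; lia.
  move: hs qE; rewrite cE size_rcons /=; case: (odd (size rs)) (odd_double_half (size rs)) => /= od hs qE.
    have := @P_last X n w hn n; rewrite EX /=.
    have := @P_mono X n w hn n.-2 n.-1; rewrite EX /=; lia.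
  lia.
have [un|un] := ltnP u n.
  by apply: lower eq _; rewrite ?entry_big //; lia.
have {un uI} uE : u = n by lia.
rewrite {}uE in hb hs hm topP hnd hsp eq lower *.
(* Undoing an addition of letters at node n. *)
have add1 rs1 : bar_column rs1 -> 1 <= s + (size rs1)%:Z + (P n)%:Z ->
   excess X n rs1 n (size rs1)%:Z = 0 ->
   column_weight rs1 < column_weight (rcons rs (Bar n)) ->
   1 <= s + (P (spin_node (odd (size rs1))))%:Z ->
   spin_sum (rcons rs (Bar n)) s = spin_sum rs1 s - B n (s + (size rs1)%:Z) ->
   Xi (spin_sum (rcons rs (Bar n)) s).
  move=> hb1 hp he hw1 hs1 e.
  apply: (Xi_raise hn hw had (r := 1) (c := n) (t := s + (size rs1)%:Z)
     (phi := spin_sum rs1 s)) => //; last by rewrite e scale1r.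
    by apply: IH => //; lia.
  move=> k k1 wk tk; rewrite (coef_spin hn hw s hb1 k1) wk tk !eqxx.
  by rewrite (_ : s + _ - s = (size rs1)%:Z); [rewrite he !mulr0|lia].
have wrc rs1 a : column_weight (rcons rs1 a) = column_weight rs1 + label_weight n a.
  by rewrite /column_weight big_rcons /= addrC.
have wn : 0 < label_weight n (Bar n) by rewrite /label_weight; lia.
have [XD|XD] := pselect (X = TypeD); last first.
  have snE b : spin_node b = n by rewrite /spin_node; case: X XD.
  apply: (add1 rs) => //.
  - by rewrite snE in hs; lia.
  - rewrite excess_barBC //; last by case: hb'.
    by case: eqP hnd => // ->; rewrite nd_irr.
  - by rewrite wrc; lia.
  - by move: hs; rewrite !snE.
  - exact: spin_addBC.
have n4 : (4 <= n)%N by move: hn; rewrite XD.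
move: {add1} (add1); case/lastP: rs hb hs hm topP hb' hnd hsp eq lower => [|rs [j|v]] hb hs hm topP hb' hnd hsp eq lower add1.
- rewrite spin_one //; apply: Xi_shifted_x => //; first by rewrite /in_I; lia.
  by move: hs; rewrite /spin_node XD.
- by case: hb' => _; rewrite all_rcons.
have ev : entry (rcons rs (Bar v)) (size rs)%:Z = Bar v by rewrite -cats1 entry_cat ltxx subrr.
have [hb2 vI hnd2] := proj1 (bar_column_rcons hn XA _ _) hb'.
rewrite size_rcons (_ : (size rs).+1%:Z - 1 = (size rs)%:Z) in hnd; last by lia.
rewrite ev nd_bars in hnd.
have [ve|vn] := eqVneq v n.-1.
  have pE : odd (size (rcons (rcons rs (Bar v)) (Bar n))) = odd (size rs).
    by rewrite !size_rcons /= negbK.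
  rewrite pE in hs topP; apply: (add1 rs) => //.
  - move: hs topP; rewrite /spin_node XD; case: rs {hb hm hb' hnd hsp eq lower add1 ev hb2 hnd2 pE} => /=.
      by lia.
    by move=> a rs hs; lia.
  - rewrite (excess_barD hn _ (proj2 hb2) XD).
    have [i ei _] := last_bar hn XA hb2; rewrite ei nd_bars in hnd2; rewrite ei !labelE.
    have -> : (i == n) = false by lia.
    by have -> : (i == n.-1) = false by lia.
  - rewrite !wrc /label_weight; lia.
  - by rewrite ve spin_addD.
apply: (lower (size rs)%:Z v) => //.
- by rewrite -cats1 entry_cat size_rcons ifT ?ev //; lia.
- rewrite -cats1 entry_cat size_rcons ifF; last by lia.
  rewrite (_ : _ - _ = 0) /= ?labelE; lia.
Qed.

End SpinReach.

Lemma nd_ltJ X n a b : X <> TypeD -> nd X n a b = ltJ X n a b.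
Proof. by rewrite /nd /leJ; case: X => // _; case: a => i; case: b => j /=; lia. Qed.

(** * Tableaux as columns and spin columns *)
Section Tableaux.
Variables (X : cartan_type) (n : nat) (w : nat -> nat).

Local Notation y := (shifted_x X n w).
Local Notation column := (column X n).
Local Notation bar_column := (bar_column X n).
Local Notation column_sum := (column_sum X n w).
Local Notation spin_sum := (spin_sum X n w).

Lemma tableau_column_sum js s : tableau X n w js s = column_sum (rev js) s.
Proof.
elim: js => [|a js IH]; first by rewrite /tableau big_ord0.
rewrite rev_cons -cats1 column_sum_cat -IH size_rev /tableau big_ord_recl.
rewrite addrC; congr (_ + _).
  apply: eq_bigr => i _; congr (box _ _ _ _ _).
  have -> : nat_of_ord (lift ord0 i) = i.+1 by exact: lift0.
  have -> : size (a :: js) = (size js).+1 by [].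
  by move: (nat_of_ord i) => m; lia.
by rewrite [RHS]addr0; congr (box _ _ _ _ _);
  rewrite -[nat_of_ord ord0]/0%N -[size (a :: js)]/(size js).+1; lia.
Qed.

Hypothesis hn : valid_rank X n.

Lemma bar_columnP rs : X <> TypeA ->
  bar_column rs <-> [/\ all is_bar rs, all (fun a => 1 <= absl a <= n)%N rs & sorted (relpre absl ltn) rs].
Proof.
move=> XA; have JE : all is_bar rs -> all (in_J X n) rs = all (fun a => 1 <= absl a <= n)%N rs.
  move=> /allP hb; apply: eq_in_all => a /hb; case: a => // j _; by case: X XA.
have SE : all is_bar rs -> sorted (nd X n) (rev rs) = sorted (relpre absl ltn) rs.
  move=> hb; rewrite rev_sorted; apply: (eq_in_sorted _ hb) => -[i|i] [j|j] // _ _.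
  by rewrite nd_bars.
by rewrite /bar_column (columnP rs hn); split=> [[/andP[h1 h2] hb]|[hb h1 h2]];
  rewrite ?JE // ?SE // in h1 h2 *; rewrite h1 h2.
Qed.

Lemma size_bar_column rs : X <> TypeA -> bar_column rs -> (size rs <= n)%N.
Proof.
move=> XA /(bar_columnP _ XA)[hb /allP hJ hs].
rewrite -(size_map absl) -[leqRHS](size_iota 1 n); apply: uniq_leq_size.
  by apply: (sorted_uniq ltn_trans ltnn); rewrite sorted_map.
by move=> j /mapP[a /hJ ha ->]; rewrite mem_iota; lia.
Qed.

Lemma spin_columnP js : X = TypeC \/ X = TypeD ->
  spin_column X n js <-> exists2 rs, bar_column rs & js = Bar n.+1 :: rev rs.
Proof.
move=> XCD; have XA : X <> TypeA by case: XCD => ->.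
have JE j : in_J X n (Bar j) = (1 <= j <= n)%N by case: XCD => ->.
split.
  case=> js' -> [h1 h2 h3 h4]; exists (rev js'); last by rewrite revK.
  have hb : all is_bar js'.
    apply/allP => a ha; move: (allP h2 _ ha) (allP h3 _ ha).
    by case: a {ha} => // j; rewrite /leJ /=; case: XCD => ->.
  apply/(bar_columnP _ XA); rewrite !all_rev rev_sorted; split => //.
    apply/allP => a ha; move: (allP hb _ ha) (allP h2 _ ha).
    by case: a {ha} => // j _; rewrite JE.
  by move: h4; rewrite /increasing (eq_in_sorted (e' := (fun x y => absl y < absl x)%N) _ hb) // => -[i|i] [j|j].
case=> rs hb ->; exists (rev rs) => //; have sz := size_bar_column XA hb.
move/(bar_columnP _ XA): hb => [hb hJ hs]; rewrite /= size_rev ltnS sz !all_rev; split => //.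
- apply/allP => a ha; move: (allP hb _ ha) (allP hJ _ ha).
  by case: a {ha} => // j _ /=; rewrite JE.
- apply/allP => a ha; move: (allP hb _ ha) (allP hJ _ ha).
  by case: a {ha} => // j _ /=; rewrite /leJ /=; lia.
- rewrite /increasing rev_sorted; move: hs.
  by rewrite (eq_in_sorted (e' := (fun x y => ltJ X n y x)) _ hb) // => -[i|i] [j|j].
Qed.

Lemma tableau_spin rs s : X = TypeC \/ X = TypeD ->
  tableau X n w (Bar n.+1 :: rev rs) s = spin_sum rs s.
Proof.
move=> XCD; rewrite tableau_column_sum rev_cons revK -cats1 column_sum_cat /spin_sum.
rewrite addrC (_ : column_sum [:: Bar n.+1] _ = y n (s + (size rs)%:Z)).
  by congr (_ + _); rewrite /spin_mult; case: XCD => ->; rewrite scale1r.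
rewrite /= addr0; case: XCD => ->; rewrite /= ?eqxx /shifted_x; congr (xx _ _ _); lia.
Qed.
End Tableaux.

(** * Columns of length n in type B *)
Section TypeB.
Variables (n : nat) (w : nat -> nat).
Hypotheses (hn : valid_rank TypeB n) (hw : index_sequence n w).

Definition bars (u : pred nat) (m : nat) : seq label := [seq Bar j | j <- iota 1 m & u j].
Definition plains (u : pred nat) (m : nat) : seq label := [seq Plain j | j <- iota 1 m & ~~ u j].

Local Notation y := (shifted_x TypeB n w).
Local Notation column_sum := (column_sum TypeB n w).
Local Notation spin_sum := (spin_sum TypeB n w).
Local Notation bar_column := (bar_column TypeB n).

Lemma iotaS m : iota 1 m.+1 = rcons (iota 1 m) m.+1.
Proof. by rewrite -cats1 -{1}(addn1 m) iotaD add1n. Qed.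

(** Induction on [m]: an unbarred m+1 shifts y_m to y_(m+1) by telescoping, and a
barred m+1 adds a box which does the same. *)
Lemma column_sum_plains u m S : column_sum (rev (plains u m)) S =
  y m S + column_sum (bars u m) (S + m%:Z - n%:Z - (size (bars u m))%:Z).
Proof.
elim: m S => [|m IH] S; first by rewrite (shifted_x_out _ hw (c := 0%N)) // addr0.
have column_sum_cons a r s : column_sum (a :: r) s = boxB n w a s + column_sum r (s + 1) by [].
rewrite /plains /bars iotaS !filter_rcons; case: (u m.+1).
  rewrite [if ~~ true then _ else _]/= map_rcons -/(bars u m) -/(plains u m) IH.
  rewrite -cats1 column_sum_cat size_cat column_sum_cons boxB_barE addn1.
  rewrite (_ : S + m.+1%:Z - n%:Z - (size (bars u m)).+1%:Z =
               S + m%:Z - n%:Z - (size (bars u m))%:Z); last by lia.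
  rewrite [column_sum [::] _](_ : _ = 0) // [m.+1.-1]/=.
  norm_times; vec_ring.
rewrite [if ~~ false then _ else _]/= map_rcons rev_rcons -/(bars u m) -/(plains u m).
rewrite column_sum_cons IH boxBE [m.+1.-1]/=.
rewrite (_ : S + 1 + m%:Z - n%:Z = S + m.+1%:Z - n%:Z); last by lia.
vec_ring.
Qed.

(** Read from the top, as the tableaux are, and not from the bottom. *)
Definition word u := plains u n ++ rev (bars u n).

Lemma column_sum_word u s : column_sum (rev (word u)) s = spin_sum (bars u n) s.
Proof.
rewrite /word rev_cat revK column_sum_cat column_sum_plains /spin_sum.
rewrite (_ : s + (size (bars u n))%:Z + n%:Z - n%:Z - (size (bars u n))%:Z = s); last by lia.
vec_ring.
Qed.

Lemma perm_word u : perm_eq [seq absl a | a <- word u] (iota 1 n).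
Proof.
rewrite /word map_cat map_rev -!map_comp.
have e s : [seq (absl \o Bar) j | j <- s] = s by rewrite map_id_in.
have e' s : [seq (absl \o Plain) j | j <- s] = s by rewrite map_id_in.
rewrite e e'; apply: (@perm_trans _ ([seq j <- iota 1 n | u j] ++ [seq j <- iota 1 n | ~~ u j])).
  by rewrite perm_catC perm_cat2r perm_rev.
by apply/permPl; apply: perm_filterC.
Qed.

Lemma bar_column_bars u : bar_column (bars u n).
Proof.
apply/(bar_columnP hn) => //; split.
- by rewrite all_map; apply/allP.
- rewrite all_map; apply/allP => j /=; rewrite mem_filter mem_iota; lia.
- by rewrite sorted_map; apply: sorted_filter; [exact: ltn_trans|exact: iota_ltn_sorted].
Qed.

Lemma ltJB_trans : transitive (ltJ TypeB n).
Proof. by move=> [j|j] [i|i] [k|k] //=; lia. Qed.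

Lemma ltJB_irr : irreflexive (ltJ TypeB n).
Proof. by move=> [j|j] /=; rewrite ltnn. Qed.

Lemma word_in u a : (a \in word u) =
  (1 <= absl a <= n)%N && (if a is Bar j then u j else ~~ u (absl a)).
Proof.
rewrite /word mem_cat mem_rev; apply/orP/idP => [[|] /mapP[j]|].
- by rewrite mem_filter mem_iota => /andP[uj jn] -> /=; rewrite uj andbT; lia.
- by rewrite mem_filter mem_iota => /andP[uj jn] -> /=; rewrite uj andbT; lia.
case: a => j /= /andP[jn uj]; [left|right]; apply: map_f; rewrite mem_filter uj mem_iota; lia.
Qed.

Lemma word_sorted u : sorted (ltJ TypeB n) (word u).
Proof.
rewrite (sorted_pairwise ltJB_trans) pairwise_cat -!(sorted_pairwise ltJB_trans).
apply/and3P; split.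
- apply/allrelP => a b /mapP[i _ ->]; rewrite mem_rev => /mapP[j _ ->] //.
- by rewrite sorted_map; apply: sorted_filter; [exact: ltn_trans|exact: iota_ltn_sorted].
- rewrite rev_sorted sorted_map; apply: sorted_filter; last exact: iota_ltn_sorted.
  by move=> j i k /=; apply: ltn_trans.
Qed.

(** The absolute values are a permutation of 1, ..., n, so the column contains
exactly one of j and its bar for each j; being sorted, it is determined by them. *)
Lemma wordP js : size js = n -> all (in_J TypeB n) js -> sorted (ltJ TypeB n) js ->
  uniq [seq absl a | a <- js] -> js = word (fun j => Bar j \in js).
Proof.
move=> sz hJ hs hu; apply: (irr_sorted_eq ltJB_trans ltJB_irr) => //; first exact: word_sorted.
have hJ' a : a \in js -> (1 <= absl a <= n)%N by move/(allP hJ); case: a.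
have [_ eqi] : (size [seq absl a | a <- js] = size (iota 1 n)) * ([seq absl a | a <- js] =i iota 1 n).
  apply: uniq_min_size => //; last by rewrite size_map sz size_iota.
  by move=> j /mapP[a /hJ' ha ->]; rewrite mem_iota; lia.
have inj : {in js &, injective absl}.
  move=> a b ha hb e; apply/eqP/negPn/negP => ne.
  have := hu; rewrite (perm_uniq (perm_map absl (perm_to_rem ha))) /= => /andP[/negP + _].
  have := perm_mem (perm_to_rem ha) b; rewrite hb inE eq_sym (negbTE ne) /= => /esym hb'.
  by case; rewrite e; apply: map_f.
move=> a; rewrite word_in; apply/idP/andP => [ha|[an ua]].
  split; first exact: hJ'.
  case: a ha => j // ha; apply/negP => hb; by have := inj _ _ ha hb erefl.
case: a an ua => j //= jn ub.
have : j \in iota 1 n by rewrite mem_iota; lia.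
rewrite -eqi => /mapP[[i|i] ha /= e]; first by rewrite e.
by move: ub; rewrite e ha.
Qed.

Lemma bar_column_barsE rs : bar_column rs -> rs = bars (fun j => Bar j \in rs) n.
Proof.
move=> /(bar_columnP hn) [] // hb hJ hs.
have lt_trans : transitive (relpre absl ltn) by move=> b a c /=; apply: ltn_trans.
have inj : map Bar (map absl rs) = rs.
  rewrite -map_comp -[RHS]map_id; apply/eq_in_map => a /(allP hb); by case: a.
rewrite -{1}inj /bars; congr (map Bar _).
apply: (irr_sorted_eq ltn_trans ltnn).
- by rewrite sorted_map.
- by apply: sorted_filter; [exact: ltn_trans|exact: iota_ltn_sorted].
move=> j; rewrite mem_filter mem_iota; apply/mapP/andP => [[a ha ->]|[h _]].
  have := allP hJ a ha; have := allP hb a ha; case: a ha => // i /= ha _ hi; split => //; lia.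
by exists (Bar j).
Qed.

End TypeB.

(** * The theorem *)
Section Families.
Variables (X : cartan_type) (n : nat) (w : nat -> nat).
Hypothesis hn : valid_rank X n.

Local Notation P := (P_ X n w).

Definition columns (phi : Qinf_dual) : Prop :=
  exists (k : nat) (s : int), [/\ (1 <= k < column_bound X n)%N, 1 <= s + (P k)%:Z & column_set X n w k s phi].

Definition spins (phi : Qinf_dual) : Prop :=
  exists (par : bool) (s : int), 1 <= s + (P (spin_node X n par))%:Z /\ spin_set X n w par s phi.

Lemma column_setP k s phi : column_set X n w k s phi <->
  exists js, [/\ size js = k, all (in_J X n) js, sorted (nd X n) js & phi = tableau X n w js s].
Proof.
split=> [[rs [hc sz ->]]|[js [sz hJ hs ->]]].
  exists (rev rs); rewrite size_rev all_rev tableau_column_sum revK.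
  by have /andP[] := proj1 (columnP rs hn) hc.
exists (rev js); rewrite size_rev tableau_column_sum; split => //.
by apply/(columnP _ hn); rewrite all_rev revK hJ.
Qed.

Lemma increasing_nd js : X <> TypeD -> increasing X n js = sorted (nd X n) js.
Proof. by move=> XD; apply: eq_sorted => a b; rewrite nd_ltJ. Qed.

End Families.

Lemma TabAP n w phi : valid_rank TypeA n -> TabA n w phi <-> columns TypeA n w phi.
Proof.
move=> hn; split.
  move=> [js [s [h1 h2 h3 h4 h5]]]; exists (size js), s; split.
  - by move: h1; rewrite /in_I.
  - by move: h4; lia.
  - by apply/(column_setP w hn); exists js; rewrite -increasing_nd.
move=> [k [s [h1 h2 /(column_setP w hn)[js [sz hJ hs ->]]]]]; exists js, s; rewrite /= sz; split => //.
- by rewrite increasing_nd.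
- by lia.
Qed.

Lemma TabBP n w phi : valid_rank TypeB n -> index_sequence n w ->
  TabB n w phi <-> columns TypeB n w phi \/ spins TypeB n w phi.
Proof.
move=> hn hw; split.
  move=> [js [s [h1 /andP[h2 h3] h4 h5 ->]]].
  have [e|ne] := eqVneq (size js) n; last first.
    left; exists (size js), s; split.
    - by move: h1; rewrite /in_I /= ; lia.
    - by move: h4; lia.
    - by apply/(column_setP w hn); exists js; rewrite -increasing_nd.
  right; exists false, s; split; first by move: h4; rewrite e /=; lia.
  rewrite (wordP hn e h2 h3 (h5 e)); exists (bars (fun j => Bar j \in js) n).
  split; [exact: bar_column_bars|by []|].
  by rewrite tableau_column_sum column_sum_word.
move=> [[k [s [h1 h2 /(column_setP w hn)[js [sz hJ hs ->]]]]]|[par [s [h1 [rs [hb _ ->]]]]]].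
  exists js, s; rewrite /= sz; split => //.
  - by move: h1; rewrite /in_I /=; lia.
  - by rewrite hJ increasing_nd.
  - by lia.
  - by move=> e; move: h1; rewrite e /= ltnn andbF.
exists (word n (fun j => Bar j \in rs)), s.
have sz : size (word n (fun j => Bar j \in rs)) = n.
  by rewrite -(size_map absl) (perm_size (perm_word n _)) size_iota.
rewrite /= sz; split.
- exact: n_in_I hn.
- rewrite /increasing word_sorted // andbT; apply/allP => a.
  by rewrite word_in // => /andP[]; case: a.
- by move: h1; rewrite /spin_node; lia.
- by move=> _; rewrite (perm_uniq (perm_word n _)) iota_uniq.
- by rewrite tableau_column_sum column_sum_word // -bar_column_barsE.
Qed.

Lemma TabCP n w phi : valid_rank TypeC n ->
  TabC n w phi <-> columns TypeC n w phi \/ spins TypeC n w phi.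
Proof.
move=> hn; have XC : TypeC = TypeC \/ TypeC = TypeD by left.
split.
  move=> [js [s [-> [[h1 h2 h3 h4]|[/(spin_columnP hn _ XC)[rs hb ->] h4]]]]].
    left; exists (size js), s; split.
    - by move: h1; rewrite /=; lia.
    - by move: h4; lia.
    - by apply/(column_setP w hn); exists js; rewrite -increasing_nd.
  right; exists false, s; split; first by rewrite /spin_node; lia.
  by exists rs; split => //; rewrite tableau_spin.
move=> [[k [s [h1 h2 /(column_setP w hn)[js [sz hJ hs ->]]]]]|[par [s [h1 [rs [hb _ ->]]]]]].
  exists js, s; rewrite /= sz; split => //; left; split => //.
  - by move: h1; rewrite /=; lia.
  - by rewrite increasing_nd.
  - by lia.
exists (Bar n.+1 :: rev rs), s; rewrite tableau_spin //; split => //; right; split.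
  by apply/(spin_columnP hn _ XC); exists rs.
by move: h1; rewrite /spin_node; lia.
Qed.

Lemma TabDP n w phi : valid_rank TypeD n ->
  TabD n w phi <-> columns TypeD n w phi \/ spins TypeD n w phi.
Proof.
move=> hn; have XD : TypeD = TypeC \/ TypeD = TypeD by right.
have n4 : (4 <= n)%N by [].
split.
  move=> [js [s [-> [[h1 h2 h3 h4]|[/(spin_columnP hn _ XD)[rs hb ->] h4]]]]].
    left; exists (size js), s; split.
    - by move: h1; rewrite /=; lia.
    - by move: h4; lia.
    - by apply/(column_setP w hn); exists js.
  right; exists (odd (size rs)), s; split.
    by move: h4; rewrite /spin_node /= size_rev; case: (odd _) => /=; lia.
  by exists rs; split => //; rewrite tableau_spin.
move=> [[k [s [h1 h2 /(column_setP w hn)[js [sz hJ hs ->]]]]]|[par [s [h1 [rs [hb hp ->]]]]]].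
  exists js, s; rewrite /= sz; split => //; left; split => //.
  - by move: h1; rewrite /=; lia.
  - by lia.
exists (Bar n.+1 :: rev rs), s; rewrite tableau_spin //; split => //; right; split.
  by apply/(spin_columnP hn _ XD); exists rs.
by move: h1; rewrite -hp // /spin_node /= size_rev; case: (odd _) => /=; lia.
Qed.

Lemma TabP X n w phi : valid_rank X n -> index_sequence n w ->
  Tab X n w phi <-> columns X n w phi \/ (X <> TypeA /\ spins X n w phi).
Proof.
case: X => hn hw /=.
- by rewrite TabAP //; split=> [|[|[]]//]; left.
- by rewrite TabBP //; split=> [[|]|[|[]]]; [left|right|left|right].
- by rewrite TabCP //; split=> [[|]|[|[]]]; [left|right|left|right].
- by rewrite TabDP //; split=> [[|]|[|[]]]; [left|right|left|right].
Qed.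

Section Stability.
Variables (X : cartan_type) (n : nat) (w : nat -> nat).
Hypotheses (hn : valid_rank X n) (hw : index_sequence n w).

Lemma stable_Tab : stable X n w (Tab X n w).
Proof.
move=> phi k /(TabP _ hn hw)[[m [s [h1 h2 h3]]]|[XA [par [s [h1 h2]]]]] k1.
  have [up dn] := stable_column hn hw h3 k1.
  by split=> [/up|/dn] h; apply/(TabP _ hn hw); left; exists m, s.
have [up dn] := stable_spin hn hw XA h2 k1.
by split=> [/up|/dn] h; apply/(TabP _ hn hw); right; split => //; exists par, s.
Qed.

Lemma Tab_x k : (1 <= k)%N -> Tab X n w (x_ k).
Proof.
move=> k1; apply/(TabP _ hn hw); have cI := w_in hw k1; have t1 := shifted_pos_gt0 X n w k1.
rewrite -(shifted_x_pos X n w k1); move: (shifted_pos X n w k) (w k) cI t1 => t c cI t1.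
have [ct|ct] := ltnP c (column_bound X n).
  left; exists c, t; split => //; first by rewrite ct andbT; case/andP: cI.
  have pE (q : nat) : (q < c)%N -> entry (rev [seq Plain j | j <- iota 1 c]) q = Plain (c - q)%N.
    move=> qc; rewrite /= nth_rev size_map size_iota // (nth_map 0%N) ?size_iota; last by lia.
    by rewrite nth_iota; [congr Plain|]; lia.
  have sz : size (rev [seq Plain j | j <- iota 1 c]) = c by rewrite size_rev size_map size_iota.
  exists (rev [seq Plain j | j <- iota 1 c]); split => //; last first.
    rewrite (column_sum_initial_run hn hw) sz ?ct // => v hv.
    by rewrite (_ : _ - _ = (c - v)%N%:Z) ?pE; [congr Plain| |]; lia.
  apply/(columnP _ hn); rewrite revK all_rev; apply/andP; split.
    rewrite all_map; apply/allP => j; rewrite mem_iota.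
    by move: ct; case: X => /=; lia.
  rewrite sorted_map; apply: (sub_sorted _ (iota_ltn_sorted 1 c)) => i j /=.
  by rewrite /nd /leJ; case: X => /=; lia.
have XA : X <> TypeA by move=> XA; move: cI ct; rewrite XA /in_I /=; lia.
right; split => //.
have [cn|cn] := eqVneq c n.
  exists false, t; split; first by move: t1; rewrite cn /spin_node; case: X.
  by exists [::]; rewrite (spin_nil X n w) cn; split => //; apply/(bar_columnP hn _ XA).
have XD : X = TypeD by move: cI ct cn; rewrite /in_I; case: X XA => //=; lia.
have n4 : (4 <= n)%N by move: hn; rewrite XD.
have ce : c = n.-1 by move: cI ct cn; rewrite /in_I XD /=; lia.
exists true, t; split.
  by rewrite (_ : spin_node X n true = c) // ce /spin_node XD.
exists [:: Bar n]; rewrite (spin_one w hn) // -ce; split => //.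
by apply/(bar_columnP hn _ XA); rewrite /= andbT; split => //; lia.
Qed.

End Stability.

Theorem theorem3p7 (X : cartan_type) (n : nat) (w : nat -> nat)
    (hn : valid_rank X n) (hw : index_sequence n w) (had : adapted X n w) :
  Xi X n w = Tab X n w.
Proof.
apply/seteqP; split => phi.
  apply: Xi_ind => [k k1|psi k k1 hpsi]; first exact: Tab_x.
  by apply: stable_S => //; apply: stable_Tab.
move=> /(TabP _ hn hw)[[k [s [hk hs [rs [hc sz ->]]]]]|[XA [par [s [hs [rs [hb hp ->]]]]]]].
  by apply: Xi_column; rewrite ?sz.
apply: Xi_spin => //; move: hs; rewrite /spin_node; case EX: X XA hp => //= _ -> //.
Qed.
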